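(* Let $K$ be a $1$-ordered simplicial set and $a,b\in K_0$. Then there is a natural isomorphism of simplicial sets $$\mathrm{Hom}_{c^hK}(a,b)\cong \operatorname*{colim}_{T\in \mathrm{Nec}(K)^{\mathrm{tnd}}_{a,b}}\mathrm{Hom}_{c^hT}(\alpha,\omega).$$
   Context: $F[m]$ denotes the standard $m$-simplex (representable simplicial set) and $Sp[m]=F[1]\amalg_{F[0]}\cdots\amalg_{F[0]}F[1]\subseteq F[m]$ its spine. **Homotopy coherent categorification.** For $m\ge0$, $c^h[m]$ is the simplicially enriched category with objects $0,\ldots,m$, $\mathrm{Hom}(i,j)=\emptyset$ for $j<i$, $\mathrm{Hom}(i,i)=\Delta[0]$, and $\mathrm{Hom}(i,j)=\prod_{\{i+1,\ldots,j-1\}}\Delta[1]$ for $i<j$, i.e. the nerve of the poset of subsets of $\{i,\ldots,j\}$ containing $i$ and $j$, with composition given by union of subsets. It is cosimplicial in $[m]$ via $J\mapsto\alpha(J)$ for $\alpha\colon[m]\to[m']$. The functor $c^h\colon\mathrm{Set}^{\Delta^{\mathrm{op}}}\to\mathrm{sSet}\text{-}\mathrm{Cat}$ is its colimit-preserving extension (left Kan extension along Yoneda), so $c^hF[m]=c^h[m]$; the object set of $c^hK$ is $K_0$. **Necklaces.** A necklace is a simplicial set $T=F[m_1]\vee\cdots\vee F[m_t]$ obtained by gluing the last vertex of $F[m_i]$ to the first vertex of $F[m_{i+1}]$ (with $m_i>0$ for all $i$ if $t>1$), bi-pointed at its initial vertex $\alpha$ and final vertex $\omega$; the $F[m_i]$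 are its beads. $\mathrm{Nec}$ is the full subcategory of bi-pointed simplicial sets on necklaces. For a simplicial set $K$ and $a,b\in K_0$, $K_{a,b}$ is $K$ bi-pointed at $(a,b)$ and $\mathrm{Nec}(K)_{a,b}$ is the category of bi-pointed maps $T\to K_{a,b}$ with $T$ a necklace (morphisms: bi-pointed maps over $K_{a,b}$). Such a necklace is totally non-degenerate if its restriction to each bead $F[m_i]$ is a non-degenerate $m_i$-simplex of $K$; $\mathrm{Nec}(K)^{\mathrm{tnd}}_{a,b}\subseteq\mathrm{Nec}(K)_{a,b}$ is the full subcategory of these. **$1$-ordered.** For $x,y\in K_0$ write $x\preceq_Ky$ if for some $m\ge0$ there is a map $Sp[m]\to K$ sending the initial vertex to $x$ and the final vertex to $y$. $K$ is $1$-ordered if $\preceq_K$ is antisymmetric and, for all $m\ge1$, (i) the restriction of the Segal map $K_m\to K_1\times_{K_0}\cdots\times_{K_0}K_1$ to the set of non-degenerate $m$-simplices is injective, and (ii) for every non-degenerate $m$-simplex $F[m]\to K$, its restriction along $Sp[m]\hookrightarrow F[m]$ is a monomorphism $Sp[m]\hookrightarrow K$. *)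

(* Defs.v *)
From Stdlib Require Import Relations.
From HB Require Import structures.
From mathcomp Require Import all_boot generic_quotient boolp.

Set Implicit Arguments.
Unset Strict Implicit.
Unset Printing Implicit Defensive.

Local Open Scope quotient_scope.

(* The quotient of [A] by the equivalence relation generated by [R]. *)
Section Quot.
Variables (A : Type) (R : A -> A -> Prop).

Definition gen_eqv : rel {classic A} := fun x y => `[< clos_refl_sym_trans A R x y >].

Lemma gen_eqv_refl : reflexive gen_eqv.
Proof. by move=> x; apply/asboolP; exact: rst_refl. Qed.

Lemma gen_eqv_sym : symmetric gen_eqv.
Proof. by move=> x y; apply/asboolP/asboolP; exact: rst_sym. Qed.

Lemma gen_eqv_trans : transitive gen_eqv.
Proof.
by move=> y x z /asboolP xy /asboolP yz; apply/asboolP; exact: rst_trans xy yz.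
Qed.

Canonical gen_eqv_equiv := EquivRel gen_eqv gen_eqv_refl gen_eqv_sym gen_eqv_trans.

Definition quot : Type := {eq_quot gen_eqv_equiv}.

Definition qclass (x : A) : quot := (\pi_({eq_quot gen_eqv_equiv}) (x : {classic A}))%qT.

Lemma qclassP (x y : A) : qclass x = qclass y <-> clos_refl_sym_trans A R x y.
Proof.
split; first by move/eqmodP => /asboolP.
by move=> xy; apply/eqmodP; apply/asboolP.
Qed.

Lemma qclass_eq (x y : A) : R x y -> qclass x = qclass y.
Proof. by move=> xy; apply/qclassP; exact: rst_step. Qed.

Lemma quot_ind (P : quot -> Prop) : (forall x, P (qclass x)) -> forall q, P q.
Proof. by move=> H q; rewrite -[q]reprK; exact: H. Qed.

Definition qlift (B : Type) (f : A -> B) (_ : forall x y, R x y -> f x = f y) (q : quot) : B :=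
  f (repr (q : {eq_quot gen_eqv_equiv})).

Lemma qliftE (B : Type) (f : A -> B) (fR : forall x y, R x y -> f x = f y) (x : A) :
  qlift fR (qclass x) = f x.
Proof.
have /qclassP: qclass (repr (qclass x : {eq_quot gen_eqv_equiv})) = qclass x.
  by rewrite /qclass reprK.
rewrite /qlift; move: (repr _) => r; elim => [u v /fR//|//|u v _ ->//|u v w _ -> _ ->//].
Qed.

End Quot.

(* The object [m] of Delta is ['I_m.+1]; [dmap m n] is Delta([m], [n]). *)
Record dmap (m n : nat) := DMap {
  dmap_fun :> {ffun 'I_m.+1 -> 'I_n.+1};
  dmap_mono : [forall i : 'I_m.+1, forall j : 'I_m.+1, (i <= j) ==> (dmap_fun i <= dmap_fun j)] }.

HB.instance Definition _ m n := [isSub for @dmap_fun m n].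
HB.instance Definition _ m n := [Finite of dmap m n by <:].

Lemma dmapP m n (f g : dmap m n) : (forall i, f i = g i) -> f = g.
Proof. by move=> fg; apply/val_inj/ffunP. Qed.

Lemma dmap_le m n (f : dmap m n) (i j : 'I_m.+1) : i <= j -> f i <= f j.
Proof. by move: (dmap_mono f) => /forallP/(_ i)/forallP/(_ j)/implyP; exact. Qed.

Lemma mkdmap_subproof m n (f : 'I_m.+1 -> 'I_n.+1) :
  (forall i j : 'I_m.+1, i <= j -> f i <= f j) ->
  [forall i : 'I_m.+1, forall j : 'I_m.+1, (i <= j) ==> ([ffun i => f i] i <= [ffun i => f i] j)].
Proof. by move=> H; apply/forallP => i; apply/forallP => j; apply/implyP; rewrite !ffunE; exact: H. Qed.

Definition mkdmap m n (f : 'I_m.+1 -> 'I_n.+1) (H : forall i j : 'I_m.+1, i <= j -> f i <= f j) :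
  dmap m n := DMap (mkdmap_subproof H).

Definition did m : dmap m m := @mkdmap m m id (fun _ _ le => le).

Definition dcomp m n p (g : dmap n p) (f : dmap m n) : dmap m p :=
  @mkdmap m p (fun i => g (f i)) (fun i j le => dmap_le g (dmap_le f le)).

Definition dconst m n (k : 'I_n.+1) : dmap m n :=
  @mkdmap m n (fun _ => k) (fun _ _ _ => leqnn k).

Lemma dcompE m n p (g : dmap n p) (f : dmap m n) i : dcomp g f i = g (f i).
Proof. by rewrite ffunE. Qed.

Lemma didE m i : did m i = i.
Proof. by rewrite ffunE. Qed.

Lemma dconstE m n (k : 'I_n.+1) i : dconst m k i = k.
Proof. by rewrite ffunE. Qed.

Lemma dcomp_id m n (f : dmap m n) : dcomp f (did m) = f.
Proof. by apply/dmapP => i; rewrite dcompE didE. Qed.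

Lemma did_comp m n (f : dmap m n) : dcomp (did n) f = f.
Proof. by apply/dmapP => i; rewrite dcompE didE. Qed.

Lemma dcompA m n p q (h : dmap p q) (g : dmap n p) (f : dmap m n) :
  dcomp h (dcomp g f) = dcomp (dcomp h g) f.
Proof. by apply/dmapP => i; rewrite !dcompE. Qed.

Lemma dcomp_const m n p (g : dmap n p) (k : 'I_n.+1) : dcomp g (dconst m k) = dconst m (g k).
Proof. by apply/dmapP => i; rewrite !dcompE !dconstE. Qed.

Lemma dconst_comp m n p (k : 'I_p.+1) (f : dmap m n) : dcomp (dconst n k) f = dconst m k.
Proof. by apply/dmapP => i; rewrite !dcompE !dconstE. Qed.

Record sset := SSet {
  simplex :> nat -> Type;
  sact : forall m n, dmap m n -> simplex n -> simplex m;
  sact_id : forall n (x : simplex n), sact (did n) x = x;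
  sact_comp : forall m n p (g : dmap n p) (f : dmap m n) (x : simplex p),
    sact (dcomp g f) x = sact f (sact g x) }.

Record smap (K L : sset) := SMap {
  smap_fun :> forall n, K n -> L n;
  smap_nat : forall m n (f : dmap m n) (x : K n), smap_fun (sact f x) = sact f (smap_fun x) }.

Lemma smapP K L (f g : smap K L) : (forall n x, f n x = g n x) -> f = g.
Proof.
case: f g => [f fn] [g gn] /= fg.
have E : f = g by apply: functional_extensionality_dep => n; apply/funext => x.
by case: _ / E in gn *; rewrite (Prop_irrelevance fn gn).
Qed.

Definition sid K : smap K K := @SMap K K (fun n x => x) (fun _ _ _ _ => erefl).

Lemma scomp_subproof K L M (g : smap L M) (f : smap K L) m n (a : dmap m n) (x : K n) :
  g m (f m (sact a x)) = sact a (g n (f n x)).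
Proof. by rewrite !smap_nat. Qed.

Definition scomp K L M (g : smap L M) (f : smap K L) : smap K M :=
  @SMap K M (fun n x => g n (f n x)) (scomp_subproof g f).

Definition siso K L (f : smap K L) : Prop :=
  exists g : smap L K, scomp g f = sid K /\ scomp f g = sid L.

(* Colimits and limits of simplicial sets being levelwise, the monomorphisms are
   the levelwise injective maps. *)
Definition smono K L (f : smap K L) : Prop := forall n, injective (f n).

Definition vertex (K : sset) m (s : K m) (i : 'I_m.+1) : K 0 := sact (dconst 0 i) s.

Lemma vertex_sact (K : sset) m n (f : dmap m n) (s : K n) (i : 'I_m.+1) :
  vertex (sact f s) i = vertex s (f i).
Proof. by rewrite /vertex -sact_comp dcomp_const. Qed.

Lemma vertex_smap K L (f : smap K L) m (s : K m) (i : 'I_m.+1) :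
  vertex (f m s) i = f 0 (vertex s i).
Proof. by rewrite /vertex smap_nat. Qed.

(* The totally degenerate [n]-simplex on the vertex [x]. *)
Definition sconst (K : sset) (x : K 0) n : K n := sact (dconst n ord0) x.

Lemma sact_sconst (K : sset) (x : K 0) m n (f : dmap m n) : sact f (sconst x n) = sconst x m.
Proof. by rewrite /sconst -sact_comp dconst_comp. Qed.

Lemma smap_sconst K L (f : smap K L) (x : K 0) n : f n (sconst x n) = sconst (f 0 x) n.
Proof. by rewrite /sconst smap_nat. Qed.

Definition stdsimplex (m : nat) : sset :=
  @SSet (fun n => dmap n m) (fun _ _ f s => dcomp s f)
    (fun n x => dcomp_id x) (fun _ _ _ g f x => dcompA x g f).

Definition yoneda (K : sset) m (s : K m) : smap (stdsimplex m) K :=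
  @SMap (stdsimplex m) K (fun n (f : dmap n m) => sact f s)
    (fun _ _ f g => sact_comp g f s).

Definition nondegenerate (K : sset) m (s : K m) : Prop :=
  ~ exists (n : nat) (p : dmap m n) (t : K n),
      [/\ n < m, (forall j, exists i, p i = j) & s = sact p t].

Record bsset := BSSet { bset :> sset; bsrc : bset 0; btgt : bset 0 }.

Record bmap (X Y : bsset) := BMap {
  bmap_smap :> smap X Y;
  bmap_src : bmap_smap 0 (bsrc X) = bsrc Y;
  bmap_tgt : bmap_smap 0 (btgt X) = btgt Y }.

Lemma bmapP X Y (f g : bmap X Y) : (forall n x, f n x = g n x) -> f = g.
Proof.
case: f g => [f f0 f1] [g g0 g1] /= /smapP E.
by case: _ / E in g0 g1 *; rewrite (Prop_irrelevance f0 g0) (Prop_irrelevance f1 g1).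
Qed.

Definition bid X : bmap X X := @BMap X X (sid X) erefl erefl.

Lemma bcomp_src X Y Z (g : bmap Y Z) (f : bmap X Y) : scomp g f 0 (bsrc X) = bsrc Z.
Proof. by rewrite /= !bmap_src. Qed.

Lemma bcomp_tgt X Y Z (g : bmap Y Z) (f : bmap X Y) : scomp g f 0 (btgt X) = btgt Z.
Proof. by rewrite /= !bmap_tgt. Qed.

Definition bcomp X Y Z (g : bmap Y Z) (f : bmap X Y) : bmap X Z :=
  BMap (bcomp_src g f) (bcomp_tgt g f).

Definition bstdsimplex (m : nat) : bsset :=
  @BSSet (stdsimplex m) (dconst 0 ord0) (dconst 0 ord_max).

Section Wedge.
Variables X Y : bsset.

Inductive wedge_glue n : X n + Y n -> X n + Y n -> Prop :=
  WedgeGlue : wedge_glue (inl (sconst (btgt X) n)) (inr (sconst (bsrc Y) n)).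

Definition wedge_act m n (f : dmap m n) (z : X n + Y n) : X m + Y m :=
  match z with inl x => inl (sact f x) | inr y => inr (sact f y) end.

Lemma wedge_act_glue m n (f : dmap m n) (z w : X n + Y n) : wedge_glue z w ->
  qclass (@wedge_glue m) (wedge_act f z) = qclass (@wedge_glue m) (wedge_act f w).
Proof. by case; rewrite /= !sact_sconst; apply/qclass_eq; constructor. Qed.

Lemma wedge_act_id n (q : quot (@wedge_glue n)) : qlift (wedge_act_glue (did n)) q = q.
Proof. by elim/quot_ind: q => -[x|y]; rewrite qliftE /= sact_id. Qed.

Lemma wedge_act_comp m n p (g : dmap n p) (f : dmap m n) (q : quot (@wedge_glue p)) :
  qlift (wedge_act_glue (dcomp g f)) q
  = qlift (wedge_act_glue f) (qlift (wedge_act_glue g) q).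
Proof. by elim/quot_ind: q => -[x|y]; rewrite !qliftE /= sact_comp. Qed.

(* The pushout of [X] and [Y] identifying the last vertex of [X] with the first of [Y]. *)
Definition wedge_sset : sset := 
  @SSet (fun n => quot (@wedge_glue n)) (fun m n f => qlift (@wedge_act_glue m n f))
    wedge_act_id wedge_act_comp.

Lemma wedge_inl_subproof m n (f : dmap m n) (x : X n) :
  qclass (@wedge_glue m) (inl (sact f x)) = sact (s := wedge_sset) f (qclass _ (inl x)).
Proof. by rewrite /= qliftE. Qed.

Lemma wedge_inr_subproof m n (f : dmap m n) (y : Y n) :
  qclass (@wedge_glue m) (inr (sact f y)) = sact (s := wedge_sset) f (qclass _ (inr y)).
Proof. by rewrite /= qliftE. Qed.

Definition wedge_inl : smap X wedge_sset := 
  @SMap X wedge_sset (fun n x => qclass (@wedge_glue n) (inl x)) wedge_inl_subproof.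
Definition wedge_inr : smap Y wedge_sset := 
  @SMap Y wedge_sset (fun n y => qclass (@wedge_glue n) (inr y)) wedge_inr_subproof.

Definition wedge : bsset :=
  @BSSet wedge_sset (wedge_inl 0 (bsrc X)) (wedge_inr 0 (btgt Y)).

Section Copair.
Variables (Z : sset) (f : smap X Z) (g : smap Y Z).
Hypothesis fg : f 0 (btgt X) = g 0 (bsrc Y).

Definition copair_fun n (z : X n + Y n) : Z n :=
  match z with inl x => f n x | inr y => g n y end.

Lemma copair_glue n (z w : X n + Y n) : wedge_glue z w -> copair_fun z = copair_fun w.
Proof. by case; rewrite /= !smap_sconst fg. Qed.

Lemma copair_nat m n (a : dmap m n) (q : wedge n) :
  qlift (@copair_glue m) (sact a q) = sact a (qlift (@copair_glue n) q).
Proof. by elim/quot_ind: q => -[x|y]; rewrite /= !qliftE /= smap_nat. Qed.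

Definition copair : smap wedge_sset Z := 
  @SMap wedge_sset Z (fun n => qlift (@copair_glue n)) copair_nat.

Lemma copair_inl n x : copair n (wedge_inl n x) = f n x.
Proof. by rewrite /= qliftE. Qed.

Lemma copair_inr n y : copair n (wedge_inr n y) = g n y.
Proof. by rewrite /= qliftE. Qed.

End Copair.
End Wedge.

Lemma bcopair_glue X Y (K : sset) (a b c : K 0) (f : bmap X (BSSet a b)) (g : bmap Y (BSSet b c)) :
  f 0 (btgt X) = g 0 (bsrc Y).
Proof. by rewrite bmap_tgt bmap_src. Qed.

Lemma bcopair_src X Y (K : sset) (a b c : K 0) (f : bmap X (BSSet a b)) (g : bmap Y (BSSet b c)) :
  copair (bcopair_glue f g) 0 (bsrc (wedge X Y)) = a.
Proof. by rewrite copair_inl bmap_src. Qed.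

Lemma bcopair_tgt X Y (K : sset) (a b c : K 0) (f : bmap X (BSSet a b)) (g : bmap Y (BSSet b c)) :
  copair (bcopair_glue f g) 0 (btgt (wedge X Y)) = c.
Proof. by rewrite copair_inr bmap_tgt. Qed.

Definition bcopair X Y (K : sset) (a b c : K 0) (f : bmap X (BSSet a b)) (g : bmap Y (BSSet b c)) :
  bmap (wedge X Y) (BSSet a c) :=
  @BMap (wedge X Y) (BSSet a c) (copair (bcopair_glue f g)) (bcopair_src f g) (bcopair_tgt f g).

Fixpoint beads_wedge (m : nat) (ms : seq nat) : bsset :=
  match ms with
  | [::] => bstdsimplex m
  | m' :: ms' => wedge (bstdsimplex m) (beads_wedge m' ms')
  end.

Record necklace := Necklace {
  bead0 : nat;
  beads : seq nat;
  necklace_pos : (beads == [::]) || all (fun m => 0 < m) (bead0 :: beads) }.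

Definition necklace_bsset (T : necklace) : bsset := beads_wedge (bead0 T) (beads T).
Coercion necklace_bsset : necklace >-> bsset.

(* The restriction of [f] to every bead is a non-degenerate simplex; the restriction
   to the bead [F[m]] is identified with the image of its top simplex [did m]. *)
Fixpoint tot_nondeg (K : sset) (m : nat) (ms : seq nat) : smap (beads_wedge m ms) K -> Prop :=
  match ms return smap (beads_wedge m ms) K -> Prop with
  | [::] => fun f => nondegenerate (f m (did m))
  | m' :: ms' => fun f =>
      nondegenerate (f m (wedge_inl (bstdsimplex m) (beads_wedge m' ms') m (did m))) /\
      @tot_nondeg K m' ms' (scomp f (wedge_inr (bstdsimplex m) (beads_wedge m' ms')))
  end.

(* Sp[0] = F[0] and Sp[m+1] is a wedge of m+1 copies of F[1]. *)
Definition spine (m : nat) : bsset :=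
  if m is m'.+1 then beads_wedge 1 (nseq m' 1) else bstdsimplex 0.

Lemma dedge_subproof m (k : 'I_m) (i j : 'I_2) : i <= j ->
  (if i == ord0 then widen_ord (leqnSn m) k else lift ord0 k)
  <= (if j == ord0 then widen_ord (leqnSn m) k else lift ord0 k).
Proof.
by case: i j => [[|[]]//= ?] [[|[]]//= ?] _; rewrite -?val_eqE /= /bump ?leq0n ?add1n.
Qed.

(* The edge k -> k+1 of F[m]. *)
Definition dedge m (k : 'I_m) : dmap 1 m := mkdmap (@dedge_subproof m k).

Lemma dshift_subproof m (i j : 'I_m.+1) : i <= j -> lift ord0 i <= lift ord0 j.
Proof. by rewrite /= /bump !leq0n. Qed.

(* The face i |-> i+1 from [m] to [m+1]. *)
Definition dshift m : dmap m m.+1 := mkdmap (@dshift_subproof m).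

Lemma dedge_src m (k : 'I_m) : dcomp (dedge k) (dconst 0 ord0) = dconst 0 (widen_ord (leqnSn m) k).
Proof. by rewrite dcomp_const ffunE. Qed.

Lemma dedge_tgt m (k : 'I_m) : dcomp (dedge k) (dconst 0 ord_max) = dconst 0 (lift ord0 k).
Proof. by rewrite dcomp_const ffunE. Qed.

Lemma spine_src_edge_src m : dcomp (dedge (@ord0 m)) (dconst 0 ord0) = dconst 0 ord0.
Proof. by rewrite dedge_src; congr (dconst 0 _); apply/val_inj. Qed.

Definition spine_src_edge m :
  bmap (bstdsimplex 1) (@BSSet (stdsimplex m.+1) (dconst 0 ord0) (dconst 0 (lift ord0 ord0))) :=
  @BMap (bstdsimplex 1) (@BSSet (stdsimplex m.+1) (dconst 0 ord0) (dconst 0 (lift ord0 ord0)))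
    (@yoneda (stdsimplex m.+1) 1 (dedge ord0)) (@spine_src_edge_src m) (dedge_tgt ord0).

Lemma spine_shift_src m : dcomp (dshift m) (dconst 0 ord0) = dconst 0 (lift ord0 ord0).
Proof. by rewrite dcomp_const ffunE. Qed.

Lemma spine_shift_tgt m : dcomp (dshift m) (dconst 0 ord_max) = dconst 0 ord_max.
Proof. by rewrite dcomp_const ffunE; congr (dconst 0 _); apply/val_inj. Qed.

Definition spine_shift m :
  bmap (bstdsimplex m) (@BSSet (stdsimplex m.+1) (dconst 0 (lift ord0 ord0)) (dconst 0 ord_max)) :=
  @BMap (bstdsimplex m) (@BSSet (stdsimplex m.+1) (dconst 0 (lift ord0 ord0)) (dconst 0 ord_max))
    (@yoneda (stdsimplex m.+1) m (dshift m)) (spine_shift_src m) (spine_shift_tgt m).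

(* On the first copy of F[1] the inclusion of the spine is the edge 0 -> 1, on the
   remaining ones it is the previous inclusion followed by i |-> i+1. *)
Fixpoint spine_incl_S (m : nat) : bmap (beads_wedge 1 (nseq m 1)) (bstdsimplex m.+1) :=
  match m with
  | 0 => bid (bstdsimplex 1)
  | m'.+1 => bcopair (spine_src_edge m'.+1) (bcomp (spine_shift m'.+1) (spine_incl_S m'))
  end.

Definition spine_incl (m : nat) : bmap (spine m) (bstdsimplex m) :=
  if m is m'.+1 then spine_incl_S m' else bid (bstdsimplex 0).

Definition preceq (K : sset) (x y : K 0) : Prop :=
  exists m : nat, inhabited (bmap (spine m) (BSSet x y)).

(* The iterated fibre product of m copies of K_1 over K_0. *)
Definition segal_target (K : sset) (m : nat) : Type :=
  {e : 'I_m -> K 1 | forall i j : 'I_m, j = i.+1 :> nat ->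
     vertex (e i) ord_max = vertex (e j) ord0}.

Lemma segal_subproof (K : sset) m (s : K m) (i j : 'I_m) : j = i.+1 :> nat ->
  vertex (sact (dedge i) s) ord_max = vertex (sact (dedge j) s) ord0.
Proof.
move=> ij; rewrite !vertex_sact !ffunE /=; congr (vertex s _).
by apply/val_inj; rewrite /= /bump leq0n add1n ij.
Qed.

Definition segal (K : sset) m (s : K m) : segal_target K m :=
  exist _ (fun i : 'I_m => sact (dedge i) s) (@segal_subproof K m s).

Record one_ordered (K : sset) : Prop := OneOrdered {
  preceq_antisym : forall x y : K 0, preceq x y -> preceq y x -> x = y;
  segal_inj : forall m (s t : K m), 1 <= m -> nondegenerate s -> nondegenerate t ->
    segal s = segal t -> s = t;
  spine_mono : forall m (s : K m), 1 <= m -> nondegenerate s ->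
    smono (scomp (yoneda s) (spine_incl m)) }.

(* Composition is written in diagrammatic order. *)
Record scat := SCat {
  sob :> Type;
  shom : sob -> sob -> sset;
  sone : forall x n, shom x x n;
  smul : forall x y z n, shom x y n -> shom y z n -> shom x z n;
  sone_nat : forall x m n (f : dmap m n), sact f (sone x n) = sone x m;
  smul_nat : forall x y z m n (f : dmap m n) (u : shom x y n) (v : shom y z n),
    sact f (smul u v) = smul (sact f u) (sact f v);
  smul1l : forall x y n (u : shom x y n), smul (sone x n) u = u;
  smul1r : forall x y n (u : shom x y n), smul u (sone y n) = u;
  smulA : forall x y z w n (u : shom x y n) (v : shom y z n) (t : shom z w n),
    smul u (smul v t) = smul (smul u v) t }.

Arguments sone {s} x n.

Record sfunctor (C D : scat) := SFunctor {
  sf_ob :> C -> D;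
  sf_hom : forall x y, smap (shom x y) (shom (sf_ob x) (sf_ob y));
  sf_one : forall x n, sf_hom x x n (sone x n) = sone (sf_ob x) n;
  sf_mul : forall x y z n (u : shom x y n) (v : shom y z n),
    sf_hom x z n (smul u v) = smul (sf_hom x y n u) (sf_hom y z n v) }.

Definition sfcomp C D E (G : sfunctor D E) (F : sfunctor C D) : sfunctor C E.
Proof.
refine (@SFunctor C E (fun x => G (F x)) (fun x y => scomp (sf_hom G _ _) (sf_hom F x y)) _ _).
- by move=> x n /=; rewrite !sf_one.
- by move=> x y z n u v /=; rewrite !sf_mul.
Defined.

Definition hom_cast (C : scat) (x x' y y' : C) (ex : x = x') (ey : y = y') :
  smap (shom x y) (shom x' y') :=
  match ex in _ = x1, ey in _ = y1 return smap (shom x y) (shom x1 y1) with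
  | erefl, erefl => sid _
  end.

(* The action of a functor on a hom object, between objects known to be the values. *)
Definition sf_hom_at C D (F : sfunctor C D) (x y : C) (x' y' : D)
    (ex : F x = x') (ey : F y = y') : smap (shom x y) (shom x' y') :=
  scomp (hom_cast ex ey) (sf_hom F x y).

Arguments sf_hom_at {C D} F {x y x' y'} ex ey.

Lemma sfunctorP C D (F G : sfunctor C D) (e : forall x, F x = G x) :
  (forall x y n (u : shom x y n), hom_cast (e x) (e y) n (sf_hom F x y n u) = sf_hom G x y n u) ->
  F = G.
Proof.
case: F G e => [F Fh F1 FM] [G Gh G1 GM] /= e.
have E : F = G by apply/funext.
case: _ / E in Gh G1 GM e *.
have -> : e = (fun=> erefl) by apply: Prop_irrelevance.
move=> /= H.
have E : Fh = Gh.
  apply: functional_extensionality_dep => x; apply: functional_extensionality_dep => y.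
  exact/smapP/H.
by case: _ / E in G1 GM *; rewrite (Prop_irrelevance F1 G1) (Prop_irrelevance FM GM).
Qed.

Lemma sfunctor_eq_hom C D (F G : sfunctor C D) (x y : C) n (u : shom x y n)
    (x' y' : D) (ex : F x = x') (ey : F y = y') (ex' : G x = x') (ey' : G y = y') :
  F = G -> sf_hom_at F ex ey n u = sf_hom_at G ex' ey' n u.
Proof. by move=> E; case: _ / E in ex' ey' *; rewrite (Prop_irrelevance ex ex') (Prop_irrelevance ey ey'). Qed.

Lemma sf_hom_at_comp C D E (G : sfunctor D E) (F : sfunctor C D) (x y : C) (x' y' : D)
    (x2 y2 : E) (ex : F x = x') (ey : F y = y') (ex' : G x' = x2) (ey' : G y' = y2)
    (e : sfcomp G F x = x2) (e' : sfcomp G F y = y2) n (u : shom x y n) :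
  sf_hom_at G ex' ey' n (sf_hom_at F ex ey n u) = sf_hom_at (sfcomp G F) e e' n u.
Proof.
case: _ / ex in ex' *; case: _ / ey in ey' *.
by rewrite (Prop_irrelevance e ex') (Prop_irrelevance e' ey').
Qed.

Lemma hom_cast_one (C : scat) (x x' : C) (e e' : x = x') n :
  hom_cast e e' n (sone x n) = sone x' n.
Proof. by rewrite (Prop_irrelevance e' e); case: _ / e. Qed.

Lemma hom_cast_mul (C : scat) (x x' y y' z z' : C) (ex : x = x') (ey : y = y') (ez : z = z') n
    (u : shom x y n) (v : shom y z n) :
  hom_cast ex ez n (smul u v) = smul (hom_cast ex ey n u) (hom_cast ey ez n v).
Proof. by case: _ / ex; case: _ / ey; case: _ / ez. Qed.

Section ChSimplex.
Variable m : nat.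

(* Subsets J of {i..j} containing i and j; there is none when j < i and exactly one
   when i = j. *)
Definition ch_face (i j : 'I_m.+1) (J : {set 'I_m.+1}) : bool :=
  [&& i \in J, j \in J & [forall (k : 'I_m.+1 | k \in J), (i <= k) && (k <= j)]].

Lemma ch_faceP (i j : 'I_m.+1) (J : {set 'I_m.+1}) :
  reflect [/\ i \in J, j \in J & forall k : 'I_m.+1, k \in J -> i <= k <= j] (ch_face i j J).
Proof.
apply: (iffP and3P) => -[iJ jJ H]; split=> //; last by apply/forall_inP.
by move=> k kJ; move/forall_inP: H; apply.
Qed.

(* n-simplices of the nerve of the poset of those subsets ordered by inclusion. *)
Record ch_chain (i j : 'I_m.+1) (n : nat) := ChChain {
  chain_fun :> {ffun 'I_n.+1 -> {set 'I_m.+1}};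
  chain_mono : [forall p, ch_face i j (chain_fun p)] &&
    [forall p : 'I_n.+1, forall q : 'I_n.+1, (p <= q) ==> (chain_fun p \subset chain_fun q)] }.

HB.instance Definition _ i j n := [isSub for @chain_fun i j n].
HB.instance Definition _ i j n := [Finite of ch_chain i j n by <:].

Lemma chainP i j n (c d : ch_chain i j n) : (forall p, c p = d p) -> c = d.
Proof. by move=> cd; apply/val_inj/ffunP. Qed.

Lemma chain_face i j n (c : ch_chain i j n) p : ch_face i j (c p).
Proof. by case/andP: (chain_mono c) => /forallP. Qed.

Lemma chain_sub i j n (c : ch_chain i j n) (p q : 'I_n.+1) : p <= q -> c p \subset c q.
Proof. by case/andP: (chain_mono c) => _ /forallP/(_ p)/forallP/(_ q)/implyP; apply. Qed.

Lemma mkchain_subproof i j n (f : 'I_n.+1 -> {set 'I_m.+1}) :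
  (forall p, ch_face i j (f p)) -> (forall p q : 'I_n.+1, p <= q -> f p \subset f q) ->
  [forall p, ch_face i j ([ffun p => f p] p)] &&
    [forall p : 'I_n.+1, forall q : 'I_n.+1, (p <= q) ==> ([ffun p => f p] p \subset [ffun p => f p] q)].
Proof.
move=> H1 H2; apply/andP; split; first by apply/forallP => p; rewrite ffunE.
by apply/forallP => p; apply/forallP => q; apply/implyP; rewrite !ffunE; apply: H2.
Qed.

Definition mkchain i j n (f : 'I_n.+1 -> {set 'I_m.+1}) (H1 : forall p, ch_face i j (f p))
    (H2 : forall p q : 'I_n.+1, p <= q -> f p \subset f q) : ch_chain i j n :=
  ChChain (mkchain_subproof H1 H2).

Definition chain_act i j n n' (f : dmap n n') (c : ch_chain i j n') : ch_chain i j n :=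
  @mkchain i j n (fun p => c (f p)) (fun p => chain_face c (f p))
    (fun p q le => chain_sub c (dmap_le f le)).

Lemma chain_act_id i j n (c : ch_chain i j n) : chain_act (did n) c = c.
Proof. by apply/chainP => p; rewrite !ffunE. Qed.

Lemma chain_act_comp i j n p q (g : dmap p q) (f : dmap n p) (c : ch_chain i j q) :
  chain_act (dcomp g f) c = chain_act f (chain_act g c).
Proof. by apply/chainP => k; rewrite !ffunE. Qed.

Definition chsimplex_hom (i j : 'I_m.+1) : sset :=
  @SSet (ch_chain i j) (@chain_act i j) (@chain_act_id i j) (@chain_act_comp i j).

Lemma chain_one_face i : ch_face i i [set i].
Proof. by apply/ch_faceP; split; rewrite ?set11// => k /set1P ->; rewrite leqnn. Qed.

Definition chain_one i n : ch_chain i i n :=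
  @mkchain i i n (fun _ => [set i]) (fun _ => chain_one_face i) (fun _ _ _ => subxx _).

Lemma chain_mul_face (i j k : 'I_m.+1) (J J' : {set 'I_m.+1}) :
  ch_face i j J -> ch_face j k J' -> ch_face i k (J :|: J').
Proof.
case/ch_faceP => iJ jJ HJ /ch_faceP[jJ' kJ' HJ'].
have /andP[ij _] := HJ _ jJ; have /andP[_ jk] := HJ' _ jJ'.
apply/ch_faceP; split; rewrite ?inE ?iJ ?kJ' ?orbT// => l.
rewrite inE => /orP[/HJ|/HJ'] /andP[l1 l2]; apply/andP; split=> //.
- exact: leq_trans l2 jk.
- exact: leq_trans ij l1.
Qed.

Definition chain_mul i j k n (c : ch_chain i j n) (d : ch_chain j k n) : ch_chain i k n :=
  @mkchain i k n (fun p => c p :|: d p)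
    (fun p => chain_mul_face (chain_face c p) (chain_face d p))
    (fun p q le => setUSS (chain_sub c le) (chain_sub d le)).

Lemma face_src i j J : ch_face i j J -> [set i] :|: J = J.
Proof. by case/ch_faceP => iJ _ _; apply/setUidPr; rewrite sub1set. Qed.

Lemma face_tgt i j J : ch_face i j J -> J :|: [set j] = J.
Proof. by case/ch_faceP => _ jJ _; apply/setUidPl; rewrite sub1set. Qed.

Definition chsimplex : scat.
Proof.
refine (@SCat 'I_m.+1 chsimplex_hom chain_one chain_mul _ _ _ _ _).
- by move=> i n n' f; apply/chainP => p; rewrite !ffunE.
- by move=> i j k n n' f u v; apply/chainP => p; rewrite !ffunE.
- by move=> i j n u; apply/chainP => p; rewrite !ffunE (face_src (chain_face u p)).
- by move=> i j n u; apply/chainP => p; rewrite !ffunE (face_tgt (chain_face u p)).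
- by move=> i j k l n u v t; apply/chainP => p; rewrite !ffunE setUA.
Defined.

End ChSimplex.

(* The cosimplicial structure J |-> alpha(J). *)
Section ChSimplexFun.
Variables (m m' : nat) (a : dmap m m').

Lemma face_img (i j : 'I_m.+1) (J : {set 'I_m.+1}) :
  ch_face i j J -> ch_face (a i) (a j) (a @: J).
Proof.
case/ch_faceP => iJ jJ H; apply/ch_faceP; split; try exact: imset_f.
by move=> k /imsetP[l /H/andP[il lj] ->]; rewrite !dmap_le.
Qed.

Definition chain_img i j n (c : ch_chain i j n) : ch_chain (a i) (a j) n :=
  @mkchain m' (a i) (a j) n (fun p => a @: c p) (fun p => face_img (chain_face c p))
    (fun p q le => imsetS a (chain_sub c le)).

Lemma chain_img_nat i j n n' (f : dmap n n') (c : ch_chain i j n') :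
  chain_img (chain_act f c) = chain_act f (chain_img c).
Proof. by apply/chainP => p; rewrite !ffunE. Qed.

Definition chsimplex_fun : sfunctor (chsimplex m) (chsimplex m').
Proof.
refine (@SFunctor (chsimplex m) (chsimplex m') a
  (fun i j => @SMap (chsimplex_hom i j) (chsimplex_hom (a i) (a j))
                (@chain_img i j) (@chain_img_nat i j)) _ _).
- by move=> i n; apply/chainP => p; rewrite !ffunE imset_set1.
- by move=> i j k n u v; apply/chainP => p; rewrite !ffunE imsetU.
Defined.

End ChSimplexFun.

(* c^h K is the colimit of the c^h[m] over the simplices s : F[m] -> K. Its objects are
   the vertices of K, and in each simplicial degree its morphisms are presented by the
   generators [ChGen s u], with u a morphism of c^h[m], and by the category axioms, the
   functoriality of u |-> ChGen s u and its compatibility with the simplicial operators;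
   [ch_universal] below is the resulting universal property. *)
Section Ch.
Variable K : sset.

Inductive ch_word (n : nat) : K 0 -> K 0 -> Type :=
| ChOne x : ch_word n x x
| ChMul x y z : ch_word n x y -> ch_word n y z -> ch_word n x z
| ChGen m (s : K m) (i j : chsimplex m) (u : shom i j n) x y :
    vertex s i = x -> vertex s j = y -> ch_word n x y.

Arguments ChOne {n} x.
Arguments ChMul {n x y z}.
Arguments ChGen {n m} s {i j} u {x y}.

Inductive ch_rel n : forall x y, ch_word n x y -> ch_word n x y -> Prop :=
| ChRel1l x y (u : ch_word n x y) : ch_rel (ChMul (ChOne x) u) u
| ChRel1r x y (u : ch_word n x y) : ch_rel (ChMul u (ChOne y)) u
| ChRelA x y z w (u : ch_word n x y) (v : ch_word n y z) (t : ch_word n z w) :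
    ch_rel (ChMul u (ChMul v t)) (ChMul (ChMul u v) t)
| ChRelMl x y z (u u' : ch_word n x y) (v : ch_word n y z) :
    ch_rel u u' -> ch_rel (ChMul u v) (ChMul u' v)
| ChRelMr x y z (u : ch_word n x y) (v v' : ch_word n y z) :
    ch_rel v v' -> ch_rel (ChMul u v) (ChMul u v')
| ChRelGen1 m (s : K m) (i : chsimplex m) x (e e' : vertex s i = x) :
    ch_rel (ChGen s (sone i n) e e') (ChOne x)
| ChRelGenM m (s : K m) (i j k : chsimplex m) (u : shom i j n) (v : shom j k n) x y z
    (ex : vertex s i = x) (ey : vertex s j = y) (ez : vertex s k = z) :
    ch_rel (ChGen s (smul u v) ex ez) (ChMul (ChGen s u ex ey) (ChGen s v ey ez))
| ChRelAct m m' (a : dmap m m') (s : K m') (i j : chsimplex m) (u : shom i j n) x y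
    (ex : vertex (sact a s) i = x) (ey : vertex (sact a s) j = y)
    (ex' : vertex s (chsimplex_fun a i) = x) (ey' : vertex s (chsimplex_fun a j) = y) :
    ch_rel (ChGen (sact a s) u ex ey)
           (ChGen s (sf_hom (chsimplex_fun a) i j n u) ex' ey').

Fixpoint ch_word_act n n' (f : dmap n n') x y (w : ch_word n' x y) : ch_word n x y :=
  match w with
  | ChOne x => ChOne x
  | ChMul _ _ _ u v => ChMul (ch_word_act f u) (ch_word_act f v)
  | ChGen _ s _ _ u _ _ ex ey => ChGen s (sact f u) ex ey
  end.

Lemma ch_word_act_rel n n' (f : dmap n n') x y (w w' : ch_word n' x y) :
  ch_rel w w' -> ch_rel (ch_word_act f w) (ch_word_act f w').
Proof.
elim=> /=; try by constructor.
- move=> m s i x1 e e'; have /= -> := @sone_nat (chsimplex m) i _ _ f.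
  exact: (@ChRelGen1 n m s i).
- move=> m s i j k u v x1 y1 z1 ex ey ez.
  have /= -> := @smul_nat (chsimplex m) i j k _ _ f u v.
  exact: (@ChRelGenM n m s i j k).
- move=> m m' a s i j u x1 y1 ex ey ex' ey'; rewrite -chain_img_nat.
  exact: (@ChRelAct n m m' a s i j).
Qed.

Lemma ch_word_act_id n x y (w : ch_word n x y) : ch_word_act (did n) w = w.
Proof.
elim: w => //= [x1 y1 z1 u -> v ->//|m s i j u x1 y1 ex ey].
by rewrite chain_act_id.
Qed.

Lemma ch_word_act_comp n p q (g : dmap p q) (f : dmap n p) x y (w : ch_word q x y) :
  ch_word_act (dcomp g f) w = ch_word_act f (ch_word_act g w).
Proof.
elim: w => //= [x1 y1 z1 u -> v ->//|m s i j u x1 y1 ex ey].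
by rewrite chain_act_comp.
Qed.

Definition ch_mor n x y : Type := quot (@ch_rel n x y).

Definition ch_cl n x y (w : ch_word n x y) : ch_mor n x y := qclass _ w.

Lemma ch_act_subproof n n' (f : dmap n n') x y (w w' : ch_word n' x y) :
  ch_rel w w' -> ch_cl (ch_word_act f w) = ch_cl (ch_word_act f w').
Proof. by move=> r; apply/qclass_eq/ch_word_act_rel. Qed.

Definition ch_act x y n n' (f : dmap n n') : ch_mor n' x y -> ch_mor n x y :=
  qlift (@ch_act_subproof n n' f x y).

Lemma ch_act_id x y n (q : ch_mor n x y) : ch_act (did n) q = q.
Proof. by elim/quot_ind: q => w; rewrite /ch_act qliftE ch_word_act_id. Qed.

Lemma ch_act_comp x y n p q (g : dmap p q) (f : dmap n p) (w : ch_mor q x y) :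
  ch_act (dcomp g f) w = ch_act f (ch_act g w).
Proof. by elim/quot_ind: w => w; rewrite /ch_act !qliftE ch_word_act_comp. Qed.

Definition ch_hom (x y : K 0) : sset :=
  @SSet (fun n => ch_mor n x y) (@ch_act x y) (@ch_act_id x y) (@ch_act_comp x y).

Lemma ch_mul_subproof_r n x y z (u : ch_word n x y) (v v' : ch_word n y z) :
  ch_rel v v' -> ch_cl (ChMul u v) = ch_cl (ChMul u v').
Proof. by move=> r; apply/qclass_eq; constructor. Qed.

Lemma ch_mul_subproof_l n x y z (u u' : ch_word n x y) :
  ch_rel u u' -> qlift (@ch_mul_subproof_r n x y z u) = qlift (@ch_mul_subproof_r n x y z u').
Proof.
move=> r; apply/funext; elim/quot_ind => v; rewrite !qliftE.
by apply/qclass_eq; constructor.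
Qed.

Definition ch_mul x y z n : ch_mor n x y -> ch_mor n y z -> ch_mor n x z :=
  qlift (@ch_mul_subproof_l n x y z).

Lemma ch_mulE x y z n (u : ch_word n x y) (v : ch_word n y z) :
  ch_mul (ch_cl u) (ch_cl v) = ch_cl (ChMul u v).
Proof. by rewrite /ch_mul !qliftE. Qed.

Lemma ch_actE x y n n' (f : dmap n n') (w : ch_word n' x y) :
  ch_act f (ch_cl w) = ch_cl (ch_word_act f w).
Proof. exact: qliftE. Qed.

Definition ch : scat.
Proof.
refine (@SCat (K 0) ch_hom (fun x n => ch_cl (ChOne x)) ch_mul _ _ _ _ _).
- by move=> x n n' f; rewrite /= ch_actE.
- move=> x y z n n' f; elim/quot_ind => u; elim/quot_ind => v.
  by rewrite -/(ch_cl u) -/(ch_cl v) /= ch_mulE !ch_actE ch_mulE.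
- move=> x y n; elim/quot_ind => u; rewrite -/(ch_cl u) ch_mulE.
  by apply/qclass_eq; constructor.
- move=> x y n; elim/quot_ind => u; rewrite -/(ch_cl u) ch_mulE.
  by apply/qclass_eq; constructor.
- move=> x y z w n; elim/quot_ind => u; elim/quot_ind => v; elim/quot_ind => t.
  rewrite -/(ch_cl u) -/(ch_cl v) -/(ch_cl t) !ch_mulE.
  by apply/qclass_eq; constructor.
Defined.

Lemma ch_incl_nat m (s : K m) (i j : chsimplex m) n n' (f : dmap n n') (u : shom i j n') :
  ch_cl (ChGen s (sact f u) erefl erefl)
  = sact (s := ch_hom (vertex s i) (vertex s j)) f (ch_cl (ChGen s u erefl erefl)).
Proof. by rewrite /= ch_actE. Qed.

(* The leg c^h[m] -> c^h K of the colimit cocone at the simplex [s]. *)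
Definition ch_incl m (s : K m) : sfunctor (chsimplex m) ch.
Proof.
refine (@SFunctor (chsimplex m) ch (vertex s)
  (fun i j => @SMap (chsimplex_hom i j) (ch_hom (vertex s i) (vertex s j))
     (fun n u => ch_cl (@ChGen n m s i j u _ _ erefl erefl)) (@ch_incl_nat m s i j)) _ _).
- by move=> i n; apply/qclass_eq; exact: (@ChRelGen1 n m s i).
- move=> i j k n u v; rewrite /= ch_mulE.
  by apply/qclass_eq; exact: (@ChRelGenM n m s i j k u v).
Defined.

End Ch.

Arguments ChOne {K n} x.
Arguments ChMul {K n x y z}.
Arguments ChGen {K n m} s {i j} u {x y}.

Section ChFun.
Variables (K L : sset) (f : smap K L).

Lemma ch_word_map_subproof m (s : K m) i x : vertex s i = x -> vertex (f m s) i = f 0 x.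
Proof. by move=> <-; rewrite vertex_smap. Qed.

Fixpoint ch_word_map n x y (w : ch_word n x y) : ch_word n (f 0 x) (f 0 y) :=
  match w with
  | ChOne x => ChOne (f 0 x)
  | ChMul _ _ _ u v => ChMul (ch_word_map u) (ch_word_map v)
  | ChGen m s _ _ u _ _ ex ey =>
      ChGen (f m s) u (ch_word_map_subproof ex) (ch_word_map_subproof ey)
  end.

Lemma ch_word_map_rel n x y (w w' : ch_word n x y) :
  ch_rel w w' -> ch_rel (ch_word_map w) (ch_word_map w').
Proof.
elim=> /=; try by constructor.
move=> m m' a s i j u x1 y1 ex ey ex' ey'.
move: (ch_word_map_subproof ex) (ch_word_map_subproof ey); rewrite smap_nat => fx fy.
by constructor.
Qed.

Lemma ch_map_subproof n x y (w w' : ch_word n x y) :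
  ch_rel w w' -> ch_cl (ch_word_map w) = ch_cl (ch_word_map w').
Proof. by move=> r; apply/qclass_eq/ch_word_map_rel. Qed.

Definition ch_mor_map x y n : ch_mor n x y -> ch_mor n (f 0 x) (f 0 y) :=
  qlift (@ch_map_subproof n x y).

Lemma ch_mor_mapE x y n (w : ch_word n x y) : ch_mor_map (ch_cl w) = ch_cl (ch_word_map w).
Proof. exact: qliftE. Qed.

Lemma ch_word_map_act n n' (a : dmap n n') x y (w : ch_word n' x y) :
  ch_word_map (ch_word_act a w) = ch_word_act a (ch_word_map w).
Proof. by elim: w => //= x1 y1 z1 u -> v ->. Qed.

Lemma ch_mor_map_nat x y n n' (a : dmap n n') (w : ch_hom x y n') :
  ch_mor_map (sact a w) = sact (s := ch_hom (f 0 x) (f 0 y)) a (ch_mor_map w).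
Proof.
by elim/quot_ind: w => w; rewrite -/(ch_cl w) /= ch_mor_mapE !ch_actE ch_mor_mapE ch_word_map_act.
Qed.

Definition ch_fun : sfunctor (ch K) (ch L).
Proof.
refine (@SFunctor (ch K) (ch L) (f 0)
  (fun x y => @SMap (ch_hom x y) (ch_hom (f 0 x) (f 0 y))
     (@ch_mor_map x y) (@ch_mor_map_nat x y)) _ _).
- by move=> x n; rewrite /= ch_mor_mapE.
- move=> x y z n; elim/quot_ind => u; elim/quot_ind => v.
  by rewrite -/(ch_cl u) -/(ch_cl v) /= ch_mulE !ch_mor_mapE ch_mulE.
Defined.

End ChFun.

Lemma ch_word_map_id (K : sset) n (x y : K 0) (w : ch_word n x y) : ch_word_map (sid K) w = w.
Proof.
elim: w => //= [x1 y1 z1 u -> v ->//|m s i j u x1 y1 ex ey].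
by congr ChGen; exact: Prop_irrelevance.
Qed.

Lemma ch_word_map_comp (K L M : sset) (g : smap L M) (f : smap K L) n (x y : K 0) (w : ch_word n x y) :
  ch_word_map (scomp g f) w = ch_word_map g (ch_word_map f w).
Proof.
elim: w => //= [x1 y1 z1 u -> v ->//|m s i j u x1 y1 ex ey].
by congr ChGen; exact: Prop_irrelevance.
Qed.

Lemma ch_fun_comp (K L M : sset) (g : smap L M) (f : smap K L) :
  ch_fun (scomp g f) = sfcomp (ch_fun g) (ch_fun f).
Proof.
refine (@sfunctorP _ _ (ch_fun (scomp g f)) (sfcomp (ch_fun g) (ch_fun f)) (fun=> erefl) _).
move=> x y n; elim/quot_ind => w; rewrite -/(ch_cl w) /= !ch_mor_mapE.
by rewrite ch_word_map_comp.
Qed.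

Lemma ch_incl_cocone (K : sset) m m' (a : dmap m m') (s : K m') :
  ch_incl (sact a s) = sfcomp (ch_incl s) (chsimplex_fun a).
Proof.
refine (@sfunctorP _ _ (ch_incl (sact a s)) (sfcomp (ch_incl s) (chsimplex_fun a))
  (vertex_sact a s) _) => i j n u.
have cl_cast x x' y y' (ex : x = x') (ey : y = y') (ex1 : vertex (sact a s) i = x)
    (ey1 : vertex (sact a s) j = y) (ex2 : vertex (sact a s) i = x')
    (ey2 : vertex (sact a s) j = y') :
    hom_cast (C := ch K) ex ey n (ch_cl (@ChGen K n m (sact a s) i j u x y ex1 ey1))
    = ch_cl (@ChGen K n m (sact a s) i j u x' y' ex2 ey2).
  case: _ / ex in ex2 *; case: _ / ey in ey2 *.
  by rewrite (Prop_irrelevance ex1 ex2) (Prop_irrelevance ey1 ey2).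
rewrite /= (cl_cast _ _ _ _ _ _ _ _ (vertex_sact a s i) (vertex_sact a s j)).
by apply/qclass_eq; exact: (@ChRelAct K n m m' a s i j u).
Qed.

Lemma ch_fun_incl (K L : sset) (f : smap K L) m (s : K m) :
  sfcomp (ch_fun f) (ch_incl s) = ch_incl (f m s).
Proof.
refine (@sfunctorP _ _ (sfcomp (ch_fun f) (ch_incl s)) (ch_incl (f m s))
  (fun i => esym (vertex_smap f s i)) _) => i j n u; rewrite /= ch_mor_mapE /=.
have cl_cast x x' y y' (ex : x = x') (ey : y = y') (ex1 : vertex (f m s) i = x)
    (ey1 : vertex (f m s) j = y) (ex2 : vertex (f m s) i = x')
    (ey2 : vertex (f m s) j = y') :
    hom_cast (C := ch L) ex ey n (ch_cl (@ChGen L n m (f m s) i j u x y ex1 ey1))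
    = ch_cl (@ChGen L n m (f m s) i j u x' y' ex2 ey2).
  case: _ / ex in ex2 *; case: _ / ey in ey2 *.
  by rewrite (Prop_irrelevance ex1 ex2) (Prop_irrelevance ey1 ey2).
exact: cl_cast.
Qed.

Section ChUniversal.
Variables (K : sset) (D : scat) (G : forall m, K m -> sfunctor (chsimplex m) D).
Hypothesis GE : forall m m' (a : dmap m m') (s : K m'),
  G (sact a s) = sfcomp (G s) (chsimplex_fun a).

Let G0 (x : K 0) : D := G x ord0.

Lemma ch_desc_ob m (s : K m) (i : 'I_m.+1) x : vertex s i = x -> G s i = G0 x.
Proof. by move=> <-; rewrite /G0 /vertex GE /= dconstE. Qed.

Fixpoint ch_word_desc n x y (w : ch_word n x y) : shom (G0 x) (G0 y) n :=
  match w with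
  | ChOne x => sone (G0 x) n
  | ChMul _ _ _ u v => smul (ch_word_desc u) (ch_word_desc v)
  | ChGen m s i j u _ _ ex ey => sf_hom_at (G s) (ch_desc_ob ex) (ch_desc_ob ey) n u
  end.

Lemma ch_word_desc_rel n x y (w w' : ch_word n x y) :
  ch_rel w w' -> ch_word_desc w = ch_word_desc w'.
Proof.
elim=> /=.
- by move=> *; rewrite smul1l.
- by move=> *; rewrite smul1r.
- by move=> *; rewrite smulA.
- by move=> x1 y1 z1 u u' v _ ->.
- by move=> x1 y1 z1 u v v' _ ->.
- move=> m s i x1 e e'; have /= -> := sf_one (G s) i n.
  exact: hom_cast_one.
- move=> m s i j k u v x1 y1 z1 ex ey ez; have /= -> := sf_mul (G s) u v.
  exact: hom_cast_mul.
- move=> m m' a s i j u x1 y1 ex ey ex' ey'.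
  exact: (@sfunctor_eq_hom _ _ (G (sact a s)) (sfcomp (G s) (chsimplex_fun a)) i j n u).
Qed.

Lemma ch_word_desc_act n n' (a : dmap n n') x y (w : ch_word n' x y) :
  ch_word_desc (ch_word_act a w) = sact a (ch_word_desc w).
Proof.
elim: w => [x1|x1 y1 z1 u IHu v IHv|m s i j u x1 y1 ex ey].
- by rewrite /= sone_nat.
- by rewrite /= IHu IHv smul_nat.
- exact: (smap_nat (sf_hom_at (G s) (ch_desc_ob ex) (ch_desc_ob ey)) a u).
Qed.

Definition ch_mor_desc x y n : ch_mor n x y -> shom (G0 x) (G0 y) n :=
  qlift (@ch_word_desc_rel n x y).

Lemma ch_mor_descE x y n (w : ch_word n x y) : ch_mor_desc (ch_cl w) = ch_word_desc w.
Proof. exact: qliftE. Qed.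

Lemma ch_mor_desc_nat x y n n' (a : dmap n n') (w : ch_hom x y n') :
  ch_mor_desc (sact a w) = sact a (ch_mor_desc w).
Proof.
by elim/quot_ind: w => w; rewrite -/(ch_cl w) /= ch_actE !ch_mor_descE ch_word_desc_act.
Qed.

Definition ch_desc : sfunctor (ch K) D.
Proof.
refine (@SFunctor (ch K) D G0 (fun x y => @SMap (ch_hom x y) (shom (G0 x) (G0 y))
  (@ch_mor_desc x y) (@ch_mor_desc_nat x y)) _ _).
- by move=> x n; rewrite /= ch_mor_descE.
- move=> x y z n; elim/quot_ind => u; elim/quot_ind => v.
  by rewrite -/(ch_cl u) -/(ch_cl v) /= ch_mulE !ch_mor_descE.
Defined.

Lemma ch_desc_incl m (s : K m) : sfcomp ch_desc (ch_incl s) = G s.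
Proof.
apply/esym; refine (@sfunctorP _ _ (G s) (sfcomp ch_desc (ch_incl s))
  (fun i => @ch_desc_ob m s i _ erefl) _) => i j n u.
rewrite /= ch_mor_descE /=; congr (hom_cast _ _ _ _); exact: Prop_irrelevance.
Qed.

Lemma ch_desc_uniq (H H' : sfunctor (ch K) D) :
  (forall m (s : K m), sfcomp H (ch_incl s) = sfcomp H' (ch_incl s)) -> H = H'.
Proof.
move=> HH'.
have v0 (x : K 0) : vertex x ord0 = x.
  rewrite /vertex (_ : dconst 0 ord0 = did 0) ?sact_id//.
  by apply/dmapP => i; rewrite dconstE didE (ord1 i).
have e x : H x = H' x.
  by move: (f_equal (fun F : sfunctor (chsimplex 0) D => F (ord0 : 'I_1)) (HH' 0 x)); rewrite /= v0.
refine (@sfunctorP _ _ H H' e _) => x y n; elim/quot_ind => w; rewrite -/(ch_cl w).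
elim: w => [x1|x1 y1 z1 u IHu v IHv|m s i j u x1 y1 ex ey].
- have /= -> := sf_one H x1 n; have /= -> := sf_one H' x1 n; exact: hom_cast_one.
- rewrite -ch_mulE; have /= -> := sf_mul H (ch_cl u) (ch_cl v).
  have /= -> := sf_mul H' (ch_cl u) (ch_cl v).
  by rewrite (hom_cast_mul _ (e y1)) IHu IHv.
- case: _ / ex; case: _ / ey.
  exact: (@sfunctor_eq_hom _ _ (sfcomp H (ch_incl s)) (sfcomp H' (ch_incl s)) i j n u
            _ _ (e _) (e _) erefl erefl (HH' m s)).
Qed.

Theorem ch_universal :
  exists! H : sfunctor (ch K) D, forall m (s : K m), sfcomp H (ch_incl s) = G s.
Proof.
exists ch_desc; split; first exact: ch_desc_incl.
by move=> H HE; apply: ch_desc_uniq => m s; rewrite ch_desc_incl HE.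
Qed.

End ChUniversal.

Definition ch_base (X : bsset) : sset := shom (s := ch X) (bsrc X) (btgt X).

Definition ch_base_map X Y (f : bmap X Y) : smap (ch_base X) (ch_base Y) :=
  sf_hom_at (ch_fun f) (bmap_src f) (bmap_tgt f).

Lemma ch_base_map_id X n (u : ch_base X n) : ch_base_map (bid X) n u = u.
Proof. by elim/quot_ind: u => w; rewrite -/(ch_cl w) /= ch_mor_mapE ch_word_map_id. Qed.

Lemma ch_base_map_comp X Y Z (g : bmap Y Z) (f : bmap X Y) n (u : ch_base X n) :
  ch_base_map (bcomp g f) n u = ch_base_map g n (ch_base_map f n u).
Proof.
rewrite /ch_base_map.
have e : sfcomp (ch_fun g) (ch_fun f) (bsrc X) = bsrc Z by exact: bmap_src (bcomp g f).
have e' : sfcomp (ch_fun g) (ch_fun f) (btgt X) = btgt Z by exact: bmap_tgt (bcomp g f).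
rewrite (sf_hom_at_comp _ _ _ _ e e').
exact/sfunctor_eq_hom/ch_fun_comp.
Qed.

Record category := Category {
  cob :> Type;
  chom : cob -> cob -> Type;
  cid : forall x, chom x x;
  ccomp : forall x y z, chom y z -> chom x y -> chom x z;
  ccomp1f : forall x y (f : chom x y), ccomp (cid y) f = f;
  ccompf1 : forall x y (f : chom x y), ccomp f (cid x) = f;
  ccompA : forall x y z w (h : chom z w) (g : chom y z) (f : chom x y),
    ccomp h (ccomp g f) = ccomp (ccomp h g) f }.

Definition full_subcategory (C : category) (P : C -> Prop) : category :=
  @Category {x : C | P x} (fun x y => chom (sval x) (sval y)) (fun x => cid (sval x))
    (fun x y z g f => ccomp g f) (fun x y f => ccomp1f f) (fun x y f => ccompf1 f)
    (fun x y z w h g f => ccompA h g f).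

Record sdiagram (J : category) := SDiagram {
  dg_ob :> J -> sset;
  dg_map : forall x y, chom x y -> smap (dg_ob x) (dg_ob y);
  dg_id : forall x, dg_map (cid x) = sid (dg_ob x);
  dg_comp : forall x y z (g : chom y z) (f : chom x y),
    dg_map (ccomp g f) = scomp (dg_map g) (dg_map f) }.

Definition full_restrict (J : category) (D : sdiagram J) (P : J -> Prop) :
  sdiagram (full_subcategory P) :=
  @SDiagram (full_subcategory P) (fun x => D (sval x)) (fun x y f => dg_map D f)
    (fun x => dg_id D (sval x)) (fun x y z g f => dg_comp D g f).

Section Colim.
Variables (J : category) (D : sdiagram J).

Inductive colim_rel n : {x : J & D x n} -> {x : J & D x n} -> Prop :=
  ColimRel x y (f : chom x y) (u : D x n) :
    colim_rel (existT _ x u) (existT _ y (dg_map D f n u)).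

Definition colim_act_pre m n (a : dmap m n) (z : {x : J & D x n}) :
  quot (@colim_rel m) := qclass _ (existT _ (projT1 z) (sact a (projT2 z))).

Lemma colim_act_rel m n (a : dmap m n) (z w : {x : J & D x n}) :
  colim_rel z w -> colim_act_pre a z = colim_act_pre a w.
Proof. by case=> x y f u; apply/qclass_eq; rewrite /= -smap_nat; constructor. Qed.

Lemma colim_act_id n (q : quot (@colim_rel n)) : qlift (colim_act_rel (did n)) q = q.
Proof. by elim/quot_ind: q => -[x u]; rewrite qliftE /colim_act_pre /= sact_id. Qed.

Lemma colim_act_comp m n p (g : dmap n p) (f : dmap m n) (q : quot (@colim_rel p)) :
  qlift (colim_act_rel (dcomp g f)) q
  = qlift (colim_act_rel f) (qlift (colim_act_rel g) q).
Proof.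
by elim/quot_ind: q => -[x u]; rewrite !qliftE /colim_act_pre /= sact_comp.
Qed.

Definition colim : sset :=
  @SSet (fun n => quot (@colim_rel n)) (fun m n a => qlift (@colim_act_rel m n a))
    colim_act_id colim_act_comp.

Lemma colim_in_nat x m n (a : dmap m n) (u : D x n) :
  qclass (@colim_rel m) (existT _ x (sact a u))
  = sact (s := colim) a (qclass (@colim_rel n) (existT _ x u)).
Proof. by rewrite /= qliftE. Qed.

Definition colim_in (x : J) : smap (D x) colim :=
  @SMap (D x) colim (fun n u => qclass (@colim_rel n) (existT _ x u)) (@colim_in_nat x).

Lemma colim_in_cocone x y (f : chom x y) : scomp (colim_in y) (dg_map D f) = colim_in x.
Proof. by apply/smapP => n u; apply/esym/qclass_eq; constructor. Qed.

Section Desc.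
Variables (L : sset) (c : forall x, smap (D x) L).
Hypothesis cE : forall x y (f : chom x y), scomp (c y) (dg_map D f) = c x.

Definition colim_desc_pre n (z : {x : J & D x n}) : L n := c (projT1 z) n (projT2 z).

Lemma colim_desc_rel n (z w : {x : J & D x n}) :
  colim_rel z w -> colim_desc_pre z = colim_desc_pre w.
Proof. by case=> x y f u; rewrite /colim_desc_pre -(cE f). Qed.

Lemma colim_desc_nat m n (a : dmap m n) (q : colim n) :
  qlift (@colim_desc_rel m) (sact a q) = sact a (qlift (@colim_desc_rel n) q).
Proof. by elim/quot_ind: q => -[x u]; rewrite /= !qliftE /colim_desc_pre /= smap_nat. Qed.

Definition colim_desc : smap colim L :=
  @SMap colim L (fun n => qlift (@colim_desc_rel n)) colim_desc_nat.

Lemma colim_desc_in x : scomp colim_desc (colim_in x) = c x.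
Proof. by apply/smapP => n u; rewrite /= qliftE. Qed.

Lemma colim_desc_uniq (g : smap colim L) :
  (forall x, scomp g (colim_in x) = c x) -> g = colim_desc.
Proof.
move=> gE; apply/smapP => n; elim/quot_ind => -[x u].
by rewrite /= qliftE /colim_desc_pre /= -(gE x).
Qed.

End Desc.
End Colim.

Section Nec.
Variables (K : sset) (a b : K 0).

Record nec_ob := NecOb { nec_neck :> necklace; nec_map : bmap nec_neck (BSSet a b) }.

Record nec_hom (T U : nec_ob) := NecHom {
  nec_bmap :> bmap T U;
  nec_over : bcomp (nec_map U) nec_bmap = nec_map T }.

Lemma nec_homP T U (f g : nec_hom T U) : (forall n x, f n x = g n x) -> f = g.
Proof.
case: f g => [f fo] [g go] /= /bmapP E.
by case: _ / E in go *; rewrite (Prop_irrelevance fo go).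
Qed.

Lemma nec_id_over (T : nec_ob) : bcomp (nec_map T) (bid T) = nec_map T.
Proof. exact: bmapP. Qed.

Lemma nec_comp_over T U V (g : nec_hom U V) (f : nec_hom T U) :
  bcomp (nec_map V) (bcomp g f) = nec_map T.
Proof. by rewrite -(nec_over f) -(nec_over g); apply: bmapP. Qed.

Definition Nec : category.
Proof.
refine (@Category nec_ob nec_hom (fun T => NecHom (nec_id_over T))
  (fun T U V g f => NecHom (nec_comp_over g f)) _ _ _).
- by move=> T U f; apply: nec_homP.
- by move=> T U f; apply: nec_homP.
- by move=> T U V W h g f; apply: nec_homP.
Defined.

Definition tnd (T : Nec) : Prop := tot_nondeg (nec_map T).

Definition NecTnd : category := full_subcategory tnd.

(* T |-> Hom_{c^h T}(alpha, omega) *)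
Definition nec_ch : sdiagram Nec.
Proof.
refine (@SDiagram Nec (fun T : nec_ob => ch_base T)
  (fun (T U : nec_ob) (f : nec_hom T U) => ch_base_map f) _ _).
- by move=> T; apply: smapP => n u; exact: ch_base_map_id.
- by move=> T U V g f; apply: smapP => n u; exact: ch_base_map_comp.
Defined.

Definition nec_tnd_ch : sdiagram NecTnd := full_restrict nec_ch tnd.

Definition nec_leg (T : NecTnd) : smap (nec_tnd_ch T) (shom (s := ch K) a b) :=
  ch_base_map (nec_map (sval T)).

Lemma nec_leg_cocone (T U : NecTnd) (f : chom T U) :
  scomp (nec_leg U) (dg_map nec_tnd_ch f) = nec_leg T.
Proof.
apply: smapP => n u.
by rewrite /nec_leg -[nec_map (sval T)](nec_over f) ch_base_map_comp.
Qed.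

(* The comparison map induced by the functors c^h T -> c^h K. *)
Definition nec_comparison : smap (colim nec_tnd_ch) (shom (s := ch K) a b) :=
  colim_desc nec_leg_cocone.

End Nec.

(* Main.v *)
(* At a fixed simplicial level, every morphism of c^h K is a composite of atoms: pairs of a
   nondegenerate m-simplex, m > 0, and a chain of subsets from {0, m} to {0, ..., m}.
   A composable list of atoms is the same thing as a totally nondegenerate necklace with a
   distinguished morphism.  If K is 1-ordered, the list is recovered from the morphism:
   vertices increase strictly along the list, so the joints and the chains are read off
   from the sets of vertices of K occurring at each level of the chains, and the simplices
   from their spines.  Conversely, a totally nondegenerate T -> K sends nondegenerate
   simplices to nondegenerate ones, so factoring u in c^h T into atoms of T gives a map over
   K from the necklace of these atoms to T; hence the class of (T, u) in the colimit depends
   only on the list of atoms of its image in c^h K. *)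
From Stdlib Require Import Relations.
Require Import Defs.
From mathcomp Require Import all_boot boolp zify.

Set Implicit Arguments.
Unset Strict Implicit.
Unset Printing Implicit Defensive.

(** * Simplicial maps and nondegenerate simplices *)

Lemma bijective_siso (K L : sset) (f : smap K L) :
  (forall n, injective (f n)) -> (forall n y, exists x, f n x = y) -> siso f.
Proof.
move=> finj fsurj.
(* Here [cid] is the choice operator, not the identity of a category. The chosen inverses are
   natural because [f] is injective. *)
pose g n y := projT1 (cid (fsurj n y)).
have fg n y : f n (g n y) = y by exact: projT2 (cid (fsurj n y)).
have gnat m n (a : dmap m n) y : g m (sact a y) = sact a (g n y).
  by apply: finj; rewrite smap_nat !fg.
exists (SMap gnat); split; apply: smapP => n x /=; last exact: fg.
by apply: finj; rewrite fg.
Qed.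

Lemma vertex0 (K : sset) (x : K 0) (i : 'I_1) : vertex x i = x.
Proof.
by rewrite /vertex (_ : dconst 0 i = did 0) ?sact_id//; apply/dmapP => j; rewrite dconstE didE !ord1.
Qed.

Lemma vertex_stdsimplex m n (x : stdsimplex m n) i : vertex x i = dconst 0 (x i).
Proof. by rewrite /vertex /= dcomp_const. Qed.

(** If [s = sact p t], the vertices of [s] factor through [p], so [p] is injective, which its drop
    in dimension forbids. *)
Lemma vertex_inj_nondegenerate (K : sset) m (s : K m) : injective (vertex s) -> nondegenerate s.
Proof.
move=> sinj [n [p [t [nm _ st]]]].
suff /leq_card: injective p by rewrite !card_ord ltnS leqNgt nm.
by move=> i j pij; apply: sinj; rewrite st !vertex_sact pij.
Qed.

Lemma smap_reflects_nondegenerate (K L : sset) (f : smap K L) m (s : K m) :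
  nondegenerate (f m s) -> nondegenerate s.
Proof.
by move=> fs [n [p [t [nm psurj st]]]]; apply: fs; exists n, p, (f n t); rewrite st smap_nat.
Qed.

Lemma nondegenerate_dim0 (K : sset) (x : K 0) : nondegenerate x.
Proof. by case=> n [p [t []]]. Qed.

Lemma dcollapse_subproof q (i : 'I_q.+1) (k l : 'I_q.+2) : k <= l ->
  (inord (unbump i k) : 'I_q.+1) <= (inord (unbump i l) : 'I_q.+1).
Proof. by move=> kl; rewrite !inordK /unbump; move: (ltn_ord i) (ltn_ord k) (ltn_ord l); lia. Qed.

(** The codegeneracy taking the value [i] twice, at [i] and [i + 1]. The value of [unbump] is in
    range, so [inord] does not change it. *)
Definition dcollapse q (i : 'I_q.+1) : dmap q.+1 q := mkdmap (@dcollapse_subproof q i).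

Lemma dlift_subproof q (i : 'I_q.+2) (k l : 'I_q.+1) : k <= l -> lift i k <= lift i l.
Proof. by rewrite leq_bump2. Qed.

Definition dlift q (i : 'I_q.+2) : dmap q q.+1 := mkdmap (@dlift_subproof q i).

Lemma dliftE q (i : 'I_q.+2) k : dlift i k = lift i k.
Proof. by rewrite ffunE. Qed.

(** If [g i = g j] with [i < j], monotonicity gives [g i = g (i + 1)], and [g] factors through the
    codegeneracy merging [i] and [i + 1]. *)
Lemma nondegenerate_dmap_inj q m (g : stdsimplex m q) : nondegenerate g -> injective (g : dmap q m).
Proof.
move=> gnd.
suff step (i : 'I_q.+1) (j : 'I_q.+1) : i < j -> g i = g j -> False.
  move=> i j gij; apply/val_inj/eqP; rewrite eqn_leq.
  by case: (ltngtP i j) => // /step H; case: H.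
case: q => [|q] in g gnd i j *; first by rewrite !ord1.
move=> ij gij; apply: gnd.
have iq : i < q.+1 by move: (ltn_ord j); lia.
pose i1 : 'I_q.+1 := Ordinal iq.
have i2q : i.+1 < q.+2 by lia.
pose i2 : 'I_q.+2 := Ordinal i2q.
(* Skipping [i + 1] and then repeating the value at [i] recovers [g]. *)
exists q, (dcollapse i1), (dcomp g (dlift i2)); split=> //.
  move=> k; exists (lift i2 k); rewrite ffunE; apply/val_inj.
  by rewrite /= inordK /= /unbump /bump; move: (ltn_ord k); lia.
apply/dmapP => k; rewrite !dcompE dliftE ffunE.
have [ki2|ki2] := eqVneq k i2.
  have -> : lift i2 (inord (unbump i1 k)) = i.
    by apply/val_inj; rewrite ki2 /= inordK /= /unbump /bump; lia.
  apply/val_inj/anti_leq; rewrite ki2.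
  by rewrite [X in _ && X]dmap_le /= ?andbT; first rewrite gij dmap_le.
congr (g _); apply/val_inj => /=.
have {}ki2 : k != i.+1 :> nat by apply: contra ki2 => /eqP e; apply/eqP/val_inj.
by rewrite inordK /= /unbump /bump; move: ki2 (ltn_ord k); lia.
Qed.

(** * Paths of edges and the order on vertices *)

Definition edge_rel (K : sset) (x y : K 0) : Prop :=
  exists e : K 1, vertex e ord0 = x /\ vertex e ord_max = y.

(** A closure of edges gives transitivity and induction without handling wedges; [sle_preceq] leads
    back to [preceq]. *)
Definition sle (K : sset) : K 0 -> K 0 -> Prop := clos_refl_trans_1n _ (@edge_rel K).

Definition byoneda (K : sset) m (s : K m) x y (ex : vertex s ord0 = x) (ey : vertex s ord_max = y) :
  bmap (bstdsimplex m) (BSSet x y) := @BMap (bstdsimplex m) (BSSet x y) (yoneda s) ex ey.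

Lemma bmap_dim0 (K : sset) (x y : K 0) (g : bmap (bstdsimplex 0) (BSSet x y)) : x = y.
Proof.
apply: etrans (esym (bmap_src g)) (etrans _ (bmap_tgt g)); congr (g 0 _).
by apply/dmapP => i; rewrite !dconstE !ord1.
Qed.

Lemma sle_preceq (K : sset) (x y : K 0) : sle x y -> preceq x y.
Proof.
elim=> [{}x|{}x z {}y [e [ex ez]] _ [m [g]]].
  by exists 0; split; exact: (byoneda (vertex0 x _) (vertex0 x _)).
(* [spine 0] is a point and not a wedge of edges, so prepending an edge to it is a separate case. *)
case: m => [|m] in g *.
  exists 1; split => /=.
  have zy : z = y := bmap_dim0 g.
  by rewrite -zy; exact: (byoneda ex ez).
by exists m.+2; split; exact: (bcopair (byoneda ex ez) g).
Qed.

Lemma sle_trans (K : sset) (x y z : K 0) : sle x y -> sle y z -> sle x z.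
Proof.
by elim=> // {}x y' {}y xy _ IH /IH; apply: Relation_Operators.rt1n_trans.
Qed.

(** Lets the embedding of spines separate all vertices of a simplex. Vertex 0 is the source of the
    first edge; the others come from the shifted spine. *)
Lemma spine_vertex m (k : 'I_m.+1) : exists v : spine m 0, spine_incl m 0 v = dconst 0 k.
Proof.
case: m k => [|m] k; first by exists (dconst 0 k).
rewrite /=.
elim: m k => [|m IH] k; first by exists (dconst 0 k).
case: (unliftP ord0 k) => [k'|] ->.
  have [v hv] := IH k'; exists (wedge_inr (bstdsimplex 1) (beads_wedge 1 (nseq m 1)) 0 v).
  by rewrite /= qliftE /= hv dcomp_const ffunE.
exists (wedge_inl (bstdsimplex 1) (beads_wedge 1 (nseq m 1)) 0 (bsrc (bstdsimplex 1))).
by rewrite /= qliftE /= dcomp_const ffunE; congr (dconst 0 _); apply/val_inj.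
Qed.

Definition ledge_fun m (i j : 'I_m.+1) (k : 'I_2) : 'I_m.+1 :=
  if k == ord0 then i else if i <= j then j else i.

Lemma ledge_subproof m (i j : 'I_m.+1) (k l : 'I_2) : k <= l -> ledge_fun i j k <= ledge_fun i j l.
Proof.
rewrite /ledge_fun; case: (eqVneq k ord0) (eqVneq l ord0) => [->|k0] [->|l0] //=.
  by case: ifP.
by case: k k0 => -[].
Qed.

(* Constant at [i] when [j < i]. *)
Definition ledge m (i j : 'I_m.+1) : dmap 1 m := mkdmap (@ledge_subproof m i j).

Lemma ledge_comp m m' (a : dmap m m') (i j : 'I_m.+1) :
  i <= j -> dcomp a (ledge i j) = ledge (a i) (a j).
Proof.
move=> ij; apply/dmapP => k; rewrite dcompE !ffunE /ledge_fun ij dmap_le //.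
by case: ifP.
Qed.

Lemma ledge_diag m (i : 'I_m.+1) : ledge i i = dconst 1 i.
Proof. by apply/dmapP => k; rewrite !ffunE /ledge_fun leqnn if_same. Qed.

Lemma ledge_src m (i j : 'I_m.+1) : ledge i j ord0 = i.
Proof. by rewrite ffunE. Qed.

Lemma ledge_tgt m (i j : 'I_m.+1) : i <= j -> ledge i j ord_max = j.
Proof. by move=> ij; rewrite ffunE /ledge_fun ij. Qed.

Lemma ledge_vertices (K : sset) m (s : K m) (i j : 'I_m.+1) : i <= j ->
  vertex (sact (ledge i j) s) ord0 = vertex s i /\ vertex (sact (ledge i j) s) ord_max = vertex s j.
Proof. by move=> ij; rewrite !vertex_sact ledge_src ledge_tgt. Qed.

Lemma sle_vertex (K : sset) m (s : K m) (i j : 'I_m.+1) : i <= j -> sle (vertex s i) (vertex s j).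
Proof.
move=> ij; apply: Relation_Operators.rt1n_trans (Relation_Operators.rt1n_refl _ _ _).
by exists (sact (ledge i j) s); exact: ledge_vertices.
Qed.

(** * Nondegenerate simplices of a 1-ordered simplicial set *)

Section OneOrdered.
Variables (K : sset) (HK : one_ordered K).

Lemma sle_antisym (x y : K 0) : sle x y -> sle y x -> x = y.
Proof. by move=> /sle_preceq xy /sle_preceq; exact: preceq_antisym. Qed.

(** The spine contains every vertex of [F[m]], and it embeds in [K]. *)
Lemma nondegenerate_vertex_inj m (s : K m) : nondegenerate s -> injective (vertex s).
Proof.
case: m s => [|m] s snd i j; first by rewrite !ord1.
have [v hv] := spine_vertex i; have [w hw] := spine_vertex j.
move=> ij; suff vw : v = w.
  by have := hw; rewrite -vw hv => /(congr1 (fun f : dmap 0 _ => f ord0)); rewrite !dconstE.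
by apply: (spine_mono HK (ltn0Sn m) snd); rewrite /scomp /= -/(spine_incl m.+1) hv hw.
Qed.

(** In a general simplicial set such a face may degenerate; here its vertices stay distinct. *)
Lemma nondegenerate_face_inj m q (s : K m) (g : dmap q m) :
  nondegenerate s -> injective g -> nondegenerate (sact g s).
Proof.
move=> snd ginj; apply: vertex_inj_nondegenerate => i j.
by rewrite !vertex_sact => /(nondegenerate_vertex_inj snd)/ginj.
Qed.

(** A simplex of a necklace lies in a single bead. If nondegenerate, it is an injective face of the
    top simplex of that bead, whose image is nondegenerate. *)
Lemma tot_nondeg_nondegenerate m ms (f : smap (beads_wedge m ms) K) q (t : beads_wedge m ms q) :
  tot_nondeg f -> nondegenerate t -> nondegenerate (f q t).
Proof.
elim: ms m f t => [|m' ms IH] m f t /=.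
  move=> fnd tnd; have -> : t = sact (t : dmap q m) (did m : stdsimplex m m).
    by rewrite /= did_comp.
  rewrite smap_nat; apply: nondegenerate_face_inj => //; exact: nondegenerate_dmap_inj.
case=> fnd fnds; elim/quot_ind: t => -[t|t] tnd.
  have -> : qclass _ (inl t)
      = wedge_inl (bstdsimplex m) (beads_wedge m' ms) q (sact (t : dmap q m) (did m : stdsimplex m m)).
    by rewrite /= did_comp.
  rewrite !smap_nat; apply: nondegenerate_face_inj => //; apply: nondegenerate_dmap_inj.
  exact: (smap_reflects_nondegenerate (f := wedge_inl (bstdsimplex m) (beads_wedge m' ms))) tnd.
apply: (IH m' _ t fnds).
exact: (smap_reflects_nondegenerate (f := wedge_inr (bstdsimplex m) (beads_wedge m' ms))) tnd.
Qed.

End OneOrdered.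

(** * Factorization into atoms *)

Record atom (K : sset) (n : nat) := Atom {
  adim : nat;
  asimp : K adim;
  achain : ch_chain (ord0 : 'I_adim.+1) ord_max n }.

Definition asrc K n (A : atom K n) : K 0 := vertex (asimp A) ord0.
Definition atgt K n (A : atom K n) : K 0 := vertex (asimp A) ord_max.

(* No interior vertex is a joint, so a good atom does not factor further, and every vertex
   of the simplex is used, so it does not come from a proper face. *)
Record good_atom (K : sset) n (A : atom K n) : Prop := GoodAtom {
  good_dim : 0 < adim A;
  good_nd : nondegenerate (asimp A);
  good_joints : achain A ord0 = [set ord0; ord_max];
  good_vertices : achain A ord_max = setT }.

Fixpoint all_good (K : sset) n (L : seq (atom K n)) : Prop :=
  if L is A :: L' then good_atom A /\ all_good L' else True.

Definition ch_gen (K : sset) n m (s : K m) (i j : 'I_m.+1) (u : ch_chain i j n) x y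
    (ex : vertex s i = x) (ey : vertex s j = y) : ch_mor n x y :=
  ch_cl (@ChGen K n m s i j u x y ex ey).

(** A relation and not a function: a list of atoms need not be composable, and its end vertices
    match [x] and [y] only up to propositional equality. *)
Fixpoint acomp (K : sset) n (L : seq (atom K n)) (x y : K 0) (q : ch_mor n x y) : Prop :=
  match L with
  | [::] => exists e : x = y, q = hom_cast (C := ch K) erefl e n (sone (s := ch K) x n)
  | A :: L' => exists z (ex : asrc A = x) (ez : atgt A = z) (v : ch_mor n z y),
      q = ch_mul (ch_gen (achain A) ex ez) v
      /\ acomp L' v
  end.

Lemma all_good_cat (K : sset) n (L L' : seq (atom K n)) :
  all_good L -> all_good L' -> all_good (L ++ L').
Proof. by elim: L => //= A L IH [gA /IH H] /H. Qed.

Section Acomp.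
Variables (K : sset) (n : nat).
Implicit Types (x y z : K 0).

Lemma ch_mulA x y z w (u : ch_mor n x y) (v : ch_mor n y z) (t : ch_mor n z w) :
  ch_mul u (ch_mul v t) = ch_mul (ch_mul u v) t.
Proof. exact: (@smulA (ch K)). Qed.

Lemma ch_mul1l x y (u : ch_mor n x y) : ch_mul (ch_cl (ChOne x)) u = u.
Proof. exact: (@smul1l (ch K)). Qed.

Lemma ch_mul1r x y (u : ch_mor n x y) : ch_mul u (ch_cl (ChOne y)) = u.
Proof. exact: (@smul1r (ch K)). Qed.

Lemma acomp1 x : acomp [::] (ch_cl (ChOne x : ch_word n x x)).
Proof. by exists erefl. Qed.

Lemma acomp_cat (L L' : seq (atom K n)) x y z (q : ch_mor n x y) (q' : ch_mor n y z) :
  acomp L q -> acomp L' q' -> acomp (L ++ L') (ch_mul q q').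
Proof.
elim: L x q => [|A L IH] x q /=.
  by case=> e -> H; case: _ / e in q' H *; rewrite ch_mul1l.
case=> w [ex [ew [v [-> Lv]]]] H.
by exists w, ex, ew, (ch_mul v q'); rewrite ch_mulA; split=> //; exact: IH.
Qed.

(** The equation on [s'] is a hypothesis so that the lemma serves both for a face and for a simplex
    known to be degenerate. *)
Lemma ch_gen_act m m' (a : dmap m m') (s : K m') (i j : 'I_m.+1) (u : ch_chain i j n) x y
    (s' : K m) (ex : vertex s' i = x) (ey : vertex s' j = y)
    (ex' : vertex s (a i) = x) (ey' : vertex s (a j) = y) : s' = sact a s ->
  ch_gen u ex ey = ch_gen (chain_img a u) ex' ey'.
Proof. by move=> E; subst s'; apply/qclass_eq; exact: (@ChRelAct K n m m' a s i j). Qed.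

Lemma ch_chain_le m (i j : 'I_m.+1) (u : ch_chain i j n) : i <= j.
Proof. by case/ch_faceP: (chain_face u ord0) => _ jJ /(_ _ jJ)/andP[]. Qed.

(** A vertex of the smallest subset lies in all of them, so each subset is the union of its parts
    below and above [k]. *)
Lemma chain_split m (i j k : 'I_m.+1) (u : ch_chain i j n) : k \in u ord0 ->
  exists (u1 : ch_chain i k n) (u2 : ch_chain k j n), u = chain_mul u1 u2.
Proof.
move=> ku0.
have ku p : k \in u p by exact: (subsetP (chain_sub u (leq0n p : ord0 <= p))).
have [fi fj] : (forall p, i \in u p) /\ (forall p, j \in u p).
  by split=> p; case/ch_faceP: (chain_face u p).
have fij p l : l \in u p -> i <= l <= j by case/ch_faceP: (chain_face u p) => _ _; apply.
have face1 p : ch_face i k [set l in u p | l <= k].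
  apply/ch_faceP; split; rewrite ?inE ?fi ?ku ?leqnn //=; first by case/andP: (fij p k (ku p)).
  by move=> l; rewrite inE => /andP[/fij/andP[-> _]].
have face2 p : ch_face k j [set l in u p | k <= l].
  apply/ch_faceP; split; rewrite ?inE ?fj ?ku ?leqnn //=; first by case/andP: (fij p k (ku p)).
  by move=> l; rewrite inE => /andP[/fij/andP[_ ->] ->].
have sub1 (p q : 'I_n.+1) : p <= q -> [set l in u p | l <= k] \subset [set l in u q | l <= k].
  by move=> pq; apply/subsetP => l; rewrite !inE => /andP[/(subsetP (chain_sub u pq)) -> ->].
have sub2 (p q : 'I_n.+1) : p <= q -> [set l in u p | k <= l] \subset [set l in u q | k <= l].
  by move=> pq; apply/subsetP => l; rewrite !inE => /andP[/(subsetP (chain_sub u pq)) -> ->].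
exists (mkchain face1 sub1), (mkchain face2 sub2).
apply/chainP => p; rewrite !ffunE; apply/setP => l; rewrite !inE -andb_orr.
by case: (ltngtP l k); rewrite andbT.
Qed.

(** A vertex missing from the largest subset is missing from all, so the chain lives on the face
    opposite to [k]. The conclusion is pointwise because the endpoints of the two chains agree only
    propositionally. *)
Lemma chain_restrict m (k : 'I_m.+2) (i j : 'I_m.+2) (u : ch_chain i j n) : k \notin u ord_max ->
  exists i' j' (u' : ch_chain i' j' n) (ei : dlift k i' = i) (ej : dlift k j' = j),
    forall p, u p = chain_img (dlift k) u' p.
Proof.
move=> ku.
have uk p : k \notin u p by apply: contra ku; apply/subsetP/chain_sub; exact: leq_ord.
have lift_of p l : l \in u p -> exists l', dlift k l' = l.
  case: (unliftP k l) => [l' ->|->]; last by rewrite (negPf (uk p)).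
  by exists l'; rewrite dliftE.
have [fi fj] : (forall p, i \in u p) /\ (forall p, j \in u p).
  by split=> p; case/ch_faceP: (chain_face u p).
have fij p l : l \in u p -> i <= l <= j by case/ch_faceP: (chain_face u p) => _ _; apply.
have [i' ei] := lift_of _ _ (fi ord0); have [j' ej] := lift_of _ _ (fj ord0).
have lele (a b : 'I_m.+1) : (dlift k a <= dlift k b) = (a <= b).
  by rewrite !dliftE /= leq_bump2.
have face p : ch_face i' j' (dlift k @^-1: u p).
  apply/ch_faceP; split; rewrite ?inE ?ei ?ej ?fi ?fj //.
  by move=> l; rewrite inE => /fij; rewrite -ei -ej !lele.
have sub (p q : 'I_n.+1) : p <= q -> dlift k @^-1: u p \subset dlift k @^-1: u q.
  by move=> pq; apply/preimsetS/chain_sub.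
exists i', j', (mkchain face sub), ei, ej => p; rewrite !ffunE.
apply/setP => l; apply/idP/imsetP => [lu|[l' + ->]]; last by rewrite inE.
by have [l' el] := lift_of _ _ lu; exists l'; rewrite ?inE el.
Qed.

(* Induction on the dimension, then on the length of the interval [i, j]: split at an
   interior joint, else pass to a face missed by the chain, else to a nondegenerate quotient. *)
Lemma acomp_gen m (s : K m) (i j : 'I_m.+1) (u : ch_chain i j n) x y
    (ex : vertex s i = x) (ey : vertex s j = y) :
  exists2 L, all_good L & acomp L (ch_gen u ex ey).
Proof.
elim/ltn_ind: m => m IHm in s i j u x y ex ey *.
move: {2}(j - i).+1 (ltnSn (j - i)) => d.
elim: d => // d IHd in i j u x y ex ey *; rewrite ltnS => jid.
have fi p : i \in u p by case/ch_faceP: (chain_face u p).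
have fj p : j \in u p by case/ch_faceP: (chain_face u p).
have fij p l : l \in u p -> i <= l <= j by case/ch_faceP: (chain_face u p) => _ _; apply.
have [ij|ij] := eqVneq i j.
  subst j; exists [::] => //.
  subst x y.
  have -> : u = chain_one i n.
    apply/chainP => p; rewrite ffunE; apply/setP => l; rewrite inE.
    by apply/idP/eqP => [/fij|->//]; rewrite -eqn_leq => /eqP/val_inj.
  by exists erefl; apply/qclass_eq; exact: (@ChRelGen1 K n m s i).
have ltij : i < j by rewrite ltn_neqAle (ch_chain_le u) andbT.
have [/existsP[k /and3P[ku ki kj]]|nok] :=
  boolP [exists k, [&& k \in u ord0, k != i & k != j]].
  have [u1 [u2 E]] := chain_split ku.
  have /andP[ik kj'] := fij _ _ ku.
  have {ki}ik' : i < k by rewrite ltn_neqAle ik andbT eq_sym.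
  have {kj kj'}kj' : k < j by rewrite ltn_neqAle kj' andbT.
  have [L1 g1 c1] := IHd i k u1 x _ ex erefl ltac:(lia).
  have [L2 g2 c2] := IHd k j u2 _ y erefl ey ltac:(lia).
  exists (L1 ++ L2); first exact: all_good_cat.
  rewrite (_ : ch_gen _ _ _ = ch_mul (ch_gen u1 ex erefl)
     (ch_gen u2 erefl ey)); first exact: acomp_cat.
  by rewrite ch_mulE E; apply/qclass_eq; exact: (@ChRelGenM K n m s i k j).
have [/existsP[k ku]|full] := boolP [exists k, k \notin u ord_max].
  case: m => [|m] in IHm s i j u ex ey fi fj fij ij nok IHd jid ltij k ku *.
    by case/eqP: ij; rewrite (ord1 i) (ord1 j).
  have [i' [j' [u' [ei [ej uE]]]]] := chain_restrict ku.
  subst i j.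
  have -> : u = chain_img (dlift k) u' by apply/chainP.
  have ex' : vertex (sact (dlift k) s) i' = x by rewrite vertex_sact.
  have ey' : vertex (sact (dlift k) s) j' = y by rewrite vertex_sact.
  rewrite -(ch_gen_act u' ex' ey' ex ey erefl); exact: IHm.
have [snd|/contrapT[q [p [t [qm _ st]]]]] := pselect (nondegenerate s); last first.
  have ex' : vertex t (p i) = x by rewrite -vertex_sact -st.
  have ey' : vertex t (p j) = y by rewrite -vertex_sact -st.
  by rewrite (ch_gen_act u ex ey ex' ey' st); exact: IHm.
(* The largest subset contains every vertex and lies between [i] and [j], which forces these to be
   the extreme vertices. *)
have umax l : l \in u ord_max by apply: contraR full => ?; apply/existsP; exists l.
have i0 : i = ord0 by apply/val_inj/eqP; rewrite /= -leqn0; case/andP: (fij _ _ (umax ord0)).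
have jm : j = ord_max.
  by apply/val_inj/eqP; rewrite /= eqn_leq -ltnS ltn_ord; case/andP: (fij _ _ (umax ord_max)).
subst i j.
exists [:: @Atom K n m s u]; last first.
  by exists y, ex, ey, (ch_cl (ChOne y)); rewrite ch_mul1r; split=> //; exact: acomp1.
split=> //; split=> //=.
  apply/setP => l; rewrite !inE; apply/idP/orP => [lu|[]/eqP->//].
  by apply/orP; apply: contraR nok; rewrite negb_or => H; apply/existsP; exists l; rewrite lu.
by apply/setP => l; rewrite inE umax.
Qed.

Lemma acomp_exists x y (q : ch_mor n x y) : exists2 L, all_good L & acomp L q.
Proof.
elim/quot_ind: q => w; rewrite -/(ch_cl w).
elim: w => [{}x|{}x {}y z u [L gL cL] v [L' gL' cL']|m s i j u {}x {}y ex ey].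
- by exists [::] => //; exact: acomp1.
- by exists (L ++ L'); [exact: all_good_cat | rewrite -ch_mulE; exact: acomp_cat].
- exact: acomp_gen.
Qed.

End Acomp.

Definition atom_map (K K' : sset) n (f : smap K K') (A : atom K n) : atom K' n :=
  Atom (f _ (asimp A)) (achain A).

Lemma acomp_map (K K' : sset) (f : smap K K') n (L : seq (atom K n)) (x y : K 0)
    (q : ch_mor n x y) : acomp L q -> acomp (map (atom_map f) L) (ch_mor_map f q).
Proof.
elim: L x q => [|A L IH] x q /=.
  by case=> e ->; case: _ / e; exists erefl; rewrite /= ch_mor_mapE.
case=> z [ex [ez [v [-> /IH Lv]]]].
exists (f 0 z), (ch_word_map_subproof f ex), (ch_word_map_subproof f ez), (ch_mor_map f v); split=> //.
have /= -> := sf_mul (ch_fun f) (ch_gen (achain A) ex ez) v.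
by rewrite ch_mor_mapE.
Qed.

(** * Invariants of words *)

Section OrdLists.
Variable m : nat.

Definition ole : rel 'I_m := relpre val leq.
Definition olt : rel 'I_m := relpre val ltn.

Lemma olt_enum (J : {set 'I_m}) : sorted olt (enum J).
Proof.
rewrite /enum_mem; apply: sorted_filter; first by move=> j i k; exact: ltn_trans.
by rewrite -enumT -sorted_map val_enum_ord iota_ltn_sorted.
Qed.

Lemma olt_eq (l l' : seq 'I_m) : sorted olt l -> sorted olt l' -> l =i l' -> l = l'.
Proof.
apply: irr_sorted_eq; first by move=> j i k; exact: ltn_trans.
by move=> i; rewrite /olt /= ltnn.
Qed.

Lemma ole_undup (l : seq 'I_m) : sorted ole l -> sorted olt (undup l).
Proof.
move=> ls; rewrite /olt -sorted_map ltn_sorted_uniq_leq map_inj_uniq; last exact: val_inj.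
rewrite undup_uniq /= sorted_map; apply: undup_sorted ls.
by move=> j i k; exact: leq_trans.
Qed.

Lemma olt_ole (l : seq 'I_m) : sorted olt l -> sorted ole l.
Proof. by apply: sub_sorted => i j; exact: ltnW. Qed.

End OrdLists.

(** Both sides are strictly increasing with the same elements: [a] is monotone, so the mapped list
    needs no sorting, only the removal of repetitions. *)
Lemma enum_imset_dmap m m' (a : dmap m m') (J : {set 'I_m.+1}) :
  enum (a @: J) = undup (map a (enum J)).
Proof.
apply: olt_eq; first exact: olt_enum.
  apply: ole_undup; apply: (homo_sorted (e := @ole _)).
    by move=> i j; exact: dmap_le.
  exact/olt_ole/olt_enum.
move=> k; rewrite mem_undup mem_enum; apply/imsetP/mapP.
  by case=> i iJ ->; exists i; rewrite ?mem_enum.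
by case=> i; rewrite mem_enum => iJ ->; exists i.
Qed.

Lemma enum_face m (i j : 'I_m.+1) (J : {set 'I_m.+1}) : ch_face i j J ->
  exists2 l, enum J = i :: l & last i l = j.
Proof.
case/ch_faceP => iJ jJ Jij.
have := olt_enum J; have := mem_enum (mem J).
case: (enum J) => [|h l] lJ /= ls; first by have := lJ i; rewrite iJ.
have lt_h k : k \in l -> h < k.
  by move: ls; rewrite path_sortedE => [/andP[/allP H _] /H//|c b d]; exact: ltn_trans.
have ih : i = h.
  have : i \in h :: l by rewrite lJ.
  rewrite inE => /orP[/eqP//|/lt_h hi].
  by have /Jij/andP[] : h \in J by [rewrite -lJ mem_head]; lia.
exists l; rewrite -?ih //; move: (mem_last i l); rewrite {2}ih lJ => /Jij/andP[_ lej].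
apply/val_inj/anti_leq; rewrite lej /=.
have: j \in h :: l by rewrite lJ.
rewrite -ih; case: (lastP l) ls {lJ lt_h lej} => [|l' k] ls; first by rewrite inE => /eqP ->.
rewrite last_rcons -rcons_cons mem_rcons inE => /orP[/eqP->//|jl].
move: ls; rewrite -ih => ls.
have : sorted (@ole m.+1) (rcons (i :: l') k) by apply: olt_ole.
(* Reversal turns the last entry into the head, where sortedness compares it with all the others. *)
rewrite -[rcons _ _]revK rev_sorted rev_rcons /= path_sortedE => [/andP[/allP H _]|c b d].
  by apply: H; rewrite mem_rev.
by move=> bc db; exact: leq_trans bc.
Qed.

Section Edges.
Variable K : sset.

Definition nd_edge m (s : K m) (i j : 'I_m.+1) : seq (K 1) :=
  if `[< nondegenerate (sact (ledge i j) s) >] then [:: sact (ledge i j) s] else [::].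

Fixpoint path_edges m (s : K m) (i : 'I_m.+1) (l : seq 'I_m.+1) : seq (K 1) :=
  if l is j :: l' then nd_edge s i j ++ path_edges s j l' else [::].

Definition set_edges m (s : K m) (J : {set 'I_m.+1}) : seq (K 1) :=
  if enum J is i :: l then path_edges s i l else [::].

Lemma path_edges_cat m (s : K m) i l l' :
  path_edges s i (l ++ l') = path_edges s i l ++ path_edges s (last i l) l'.
Proof. by elim: l i => //= j l IH i; rewrite IH catA. Qed.

Lemma set_edges1 m (s : K m) i : set_edges s [set i] = [::].
Proof. by rewrite /set_edges enum_set1. Qed.

(** The two enumerations share exactly [j], at the end of one and the start of the other, so the
    edge paths concatenate. *)
Lemma set_edgesU m (s : K m) i j k J J' : ch_face i j J -> ch_face j k J' ->
  set_edges s (J :|: J') = set_edges s J ++ set_edges s J'.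
Proof.
move=> fJ fJ'; have [l El lj] := enum_face fJ; have [l' El' _] := enum_face fJ'.
rewrite /set_edges El El'; suff -> : enum (J :|: J') = i :: l ++ l'.
  by rewrite path_edges_cat lj.
apply: olt_eq; first exact: olt_enum.
  have := olt_enum J; have := olt_enum J'; rewrite El El' /= => jl' il.
  by rewrite cat_path il lj.
move=> c; rewrite -cat_cons -El mem_cat !mem_enum inE.
rewrite -[in RHS]mem_enum -[c \in J']mem_enum El' inE.
have [->|_] := eqVneq c j; last by rewrite mem_enum.
by case/ch_faceP: fJ => _ jJ _; rewrite mem_enum jJ.
Qed.

Lemma nd_edge_diag m (s : K m) i : nd_edge s i i = [::].
Proof.
rewrite /nd_edge ledge_diag; case: asboolP => // -[].
exists 0, (dconst 1 ord0), (sact (dconst 0 i) s); split=> //.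
  by move=> j; exists ord0; rewrite dconstE ord1.
by rewrite -sact_comp dconst_comp.
Qed.

Lemma path_edges_act m m' (a : dmap m m') (s : K m') i l : path (@ole _) i l ->
  path_edges (sact a s) i l = path_edges s (a i) (map a l).
Proof.
elim: l i => //= j l IH i /andP[ij jl]; rewrite IH // /nd_edge.
by rewrite -!sact_comp ledge_comp.
Qed.

(** In a sorted list repetitions are adjacent, and a repeated vertex contributes only a degenerate
    edge, which [nd_edge] drops. *)
Lemma path_edges_undup m (s : K m) i l : path (@ole _) i l ->
  exists2 r, undup (i :: l) = i :: r & path_edges s i r = path_edges s i l.
Proof.
elim: l i => [|j l IH] i; first by exists [::].
move=> /= /andP[ij jl]; have [r /= -> Er] := IH _ jl.
case: ifP => [|_]; last by exists (j :: r); rewrite //= Er.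
rewrite inE => /orP ijl; have -> : i = j.
  case: ijl => [/eqP//|il]; apply/val_inj/anti_leq; rewrite [val i <= _]ij /=.
  by move: jl; rewrite path_sortedE => [/andP[/allP/(_ _ il)]|c b d] //; exact: leq_trans.
by exists r; rewrite //= nd_edge_diag.
Qed.

Lemma set_edges_act m m' (a : dmap m m') (s : K m') (J : {set 'I_m.+1}) :
  set_edges (sact a s) J = set_edges s (a @: J).
Proof.
rewrite /set_edges enum_imset_dmap; have := olt_ole (olt_enum J).
case: (enum J) => [//|i l] il; rewrite path_edges_act //.
have ail : path (@ole _) (a i) (map a l).
  by apply: (homo_path (e := @ole _)) il => b c; exact: dmap_le.
by have [r -> ->] := path_edges_undup s ail.
Qed.

Section Words.
Variable n : nat.

(* Dropping the degenerate edges makes the spine of the largest subset invariant under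
   degeneracies, hence under [ChRelAct]. *)
Fixpoint word_edges x y (w : ch_word n x y) : seq (K 1) :=
  match w with
  | ChOne _ => [::]
  | ChMul _ _ _ u v => word_edges u ++ word_edges v
  | ChGen m s i j u _ _ _ _ => set_edges s ((u : ch_chain i j n) ord_max)
  end.

Lemma word_edges_rel x y (w w' : ch_word n x y) : ch_rel w w' -> word_edges w = word_edges w'.
Proof.
elim=> {x y w w'} //=.
- by move=> x y u; rewrite cats0.
- by move=> x y z w u v t; rewrite catA.
- by move=> x y z u u' v _ ->.
- by move=> x y z u v v' _ ->.
- by move=> m s i x _ _; rewrite ffunE set_edges1.
- move=> m s i j k u v x y z _ _ _; rewrite ffunE.
  by apply: set_edgesU; exact: chain_face.
- by move=> m m' a s i j u x y _ _ _ _; rewrite ffunE set_edges_act.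
Qed.

Definition mor_edges x y : ch_mor n x y -> seq (K 1) := qlift (@word_edges_rel x y).

Variable p : 'I_n.+1.

Definition chain_vset m (s : K m) (i j : 'I_m.+1) (u : ch_chain i j n) (z : K 0) : Prop :=
  exists2 k, k \in u p & vertex s k = z.

Fixpoint word_vset x y (w : ch_word n x y) : K 0 -> Prop :=
  match w with
  | ChOne x => fun z => z = x
  | ChMul _ _ _ u v => fun z => word_vset u z \/ word_vset v z
  | ChGen m s i j u _ _ _ _ => chain_vset s (u : ch_chain i j n)
  end.

(** Needed for the unit relations: composing with an identity adjoins an end vertex, which is
    already present. *)
Lemma word_vset_ends x y (w : ch_word n x y) : word_vset w x /\ word_vset w y.
Proof.
elim: w => //= [{}x {}y z u [ux uy] v [vy vz]|m s i j u {}x {}y ex ey]; first by split; [left|right].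
by case/ch_faceP: (chain_face u p) => iu ju _; split; [exists i|exists j].
Qed.

Lemma word_vset_rel x y (w w' : ch_word n x y) : ch_rel w w' -> word_vset w = word_vset w'.
Proof.
move=> r; apply/funext => t; apply/propext; elim: r => {x y w w'} /=.
- by move=> x y u; split; [case=> // ->; case: (word_vset_ends u)|right].
- by move=> x y u; split; [case=> // ->; case: (word_vset_ends u)|left].
- by move=> x y z w u v t'; split; tauto.
- by move=> x y z u u' v _ IH; tauto.
- by move=> x y z u u' v _ IH; tauto.
- move=> m s i x ex _; rewrite /chain_vset; split; last by move=> ->; exists i; rewrite ?ffunE ?set11.
  by case=> k; rewrite ffunE inE => /eqP -> <-.
- move=> m s i j k u v x y z _ _ _; rewrite /chain_vset; split.
    by case=> l; rewrite ffunE inE => /orP[] lu <-; [left|right]; exists l.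
  by case=> -[l lu <-]; exists l; rewrite // ffunE inE lu ?orbT.
- move=> m m' a s i j u x y _ _ _ _; rewrite /chain_vset; split.
    by case=> k ku; rewrite vertex_sact => <-; exists (a k); rewrite // ffunE imset_f.
  by case=> k; rewrite ffunE => /imsetP[l lu ->] <-; exists l; rewrite ?vertex_sact.
Qed.

Definition mor_vset x y : ch_mor n x y -> K 0 -> Prop := qlift (@word_vset_rel x y).

Fixpoint atoms_vset (L : seq (atom K n)) (z : K 0) : Prop :=
  if L is A :: L' then chain_vset (asimp A) (achain A) z \/ atoms_vset L' z else False.

Definition atoms_edges (L : seq (atom K n)) : seq (K 1) :=
  flatten [seq set_edges (asimp A) (achain A ord_max) | A <- L].

Lemma acomp_edges L x y (q : ch_mor n x y) : acomp L q -> mor_edges q = atoms_edges L.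
Proof.
elim: L x q => [|A L IH] x q /=; first by case=> e ->; case: _ / e; rewrite /mor_edges qliftE.
case=> z [ex [ez [v [-> /IH]]]]; rewrite /atoms_edges /= => <-.
by elim/quot_ind: v => v; rewrite ch_mulE /mor_edges !qliftE.
Qed.

(** The disjunct [z = x] accounts for the empty list: an identity has the vertex [x], while
    [atoms_vset] is then empty. *)
Lemma acomp_vset L x y (q : ch_mor n x y) z : acomp L q ->
  mor_vset q z <-> z = x \/ atoms_vset L z.
Proof.
elim: L x q => [|A L IH] x q /=.
  by case=> e ->; case: _ / e; rewrite /mor_vset qliftE /=; tauto.
case=> t [ex [et [v [-> /IH]]]].
elim/quot_ind: v => v; rewrite ch_mulE /mor_vset !qliftE /= => H.
case/ch_faceP: (chain_face (achain A) p) => iu ju _.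
split; last by case=> [->|]; [left; exists ord0|tauto].
case=> [|/H[->|]]; [tauto| |tauto].
by right; left; exists ord_max.
Qed.

Lemma acomp_sle L x y (q : ch_mor n x y) z : acomp L q -> atoms_vset L z -> sle x z.
Proof.
elim: L x q => //= A L IH x q [t [ex [et [v [_ vL]]]]] [[k _ <-]|/(IH _ _ vL)].
  by rewrite -ex; exact: sle_vertex.
by apply: sle_trans; rewrite -ex -et; exact: sle_vertex.
Qed.

End Words.
End Edges.

(** * Uniqueness of the factorization in the 1-ordered case *)

Section Uniqueness.
Variables (K : sset) (HK : one_ordered K) (n : nat).

Lemma dedge_ledge m (k : 'I_m) : dedge k = ledge (widen_ord (leqnSn m) k) (lift ord0 k).
Proof.
apply/dmapP => i; rewrite !ffunE /ledge_fun.
by have -> : widen_ord (leqnSn m) k <= lift ord0 k by rewrite /= /bump; lia.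
Qed.

(** The edges along a strictly increasing path are injective faces of [s], hence nondegenerate, and
    none is dropped. *)
Lemma path_edges_nondegenerate m (s : K m) i l : nondegenerate s -> path (@olt _) i l ->
  path_edges s i l = pairmap (fun j k => sact (ledge j k) s) i l.
Proof.
move=> snd; elim: l i => //= j l IH i /andP[ij /IH ->]; rewrite /nd_edge asboolT //.
apply: nondegenerate_face_inj => // a b; rewrite !ffunE /ledge_fun (ltnW ij).
case: (eqVneq a ord0) (eqVneq b ord0) => [->|a0] [->|b0] // E.
- by move: ij; rewrite /olt /= E ltnn.
- by move: ij; rewrite /olt /= E ltnn.
- by apply/val_inj; case: a a0 {E} b b0 => -[|[]]// ? _ [[|[]]].
Qed.

(** For a good atom the edge invariant thus lists the components of the Segal map. *)
Lemma set_edgesT m (s : K m) : nondegenerate s ->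
  set_edges s setT = [seq sact (dedge k) s | k <- enum 'I_m].
Proof.
move=> snd; rewrite /set_edges; have := olt_enum [set: 'I_m.+1].
rewrite enum_setT -enumT enum_ordSl => lts; rewrite path_edges_nondegenerate //.
case: m => [|m] in s snd lts *; first by case: (enum 'I_0) (size_enum_ord 0).
set e0 := sact (dedge (ord0 : 'I_m.+1)) s.
apply: (@eq_from_nth _ e0); rewrite size_pairmap !size_map // -enumT size_enum_ord => k km.
rewrite (nth_pairmap ord0) ?size_map -?enumT ?size_enum_ord // (nth_map (Ordinal km)) ?size_enum_ord //.
rewrite dedge_ledge (nth_map (Ordinal km)) ?size_enum_ord //.
have Ek : nth (Ordinal km) (enum 'I_m.+1) k = Ordinal km.
  by apply/val_inj; rewrite /= nth_enum_ord.
rewrite Ek -enum_ordSl; congr (sact (ledge _ _) s); apply/val_inj.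
by rewrite /= nth_enum_ord //; lia.
Qed.

Lemma good_atom_edges (A : atom K n) : good_atom A ->
  set_edges (asimp A) (achain A ord_max) = [seq sact (dedge k) (asimp A) | k <- enum 'I_(adim A)].
Proof. by case=> _ Ad _ ->; exact: set_edgesT. Qed.


(** The vertices of later atoms lie above the target of [A], whereas [k] lies strictly below it. *)
Lemma atom_vertex_notin (A : atom K n) L y (v : ch_mor n (atgt A) y) (k : 'I_(adim A).+1) p :
  good_atom A -> acomp L v -> k < adim A -> ~ atoms_vset p L (vertex (asimp A) k).
Proof.
move=> gA vL kA /(acomp_sle vL) tk.
have kt : sle (vertex (asimp A) k) (atgt A) by apply: sle_vertex; exact: leq_ord.
have := nondegenerate_vertex_inj HK (good_nd gA) (sle_antisym HK kt tk).
by move=> E; move: kA; rewrite E ltnn.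
Qed.

(** The concatenated edge list does not show where an atom ends, but its first [adim A] entries
    belong to both heads. *)
Lemma atoms_prefix (A B : atom K n) L L' :
  good_atom A -> good_atom B -> asrc A = asrc B ->
  atoms_edges (A :: L) = atoms_edges (B :: L') -> adim A <= adim B ->
  forall (k : 'I_(adim A)) (k' : 'I_(adim B)), k = k' :> nat ->
  sact (dedge k) (asimp A) = sact (dedge k') (asimp B).
Proof.
move=> gA gB AB; rewrite /atoms_edges /= !good_atom_edges // => E le_AB k k' kk'.
set e := sact (dedge k) (asimp A).
have := congr1 (fun l => nth e l k) E.
rewrite !nth_cat !size_map -!enumT !size_enum_ord ltn_ord {2}kk' ltn_ord.
rewrite (nth_map k) ?size_enum_ord // (nth_map k') ?size_enum_ord ?kk' //.
rewrite (_ : nth k _ k' = k); last by apply/val_inj; rewrite /= nth_enum_ord // -kk'.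
by rewrite (_ : nth k' _ k' = k') //; apply/val_inj; rewrite /= nth_enum_ord.
Qed.

(** Otherwise the target of [A], a vertex at level 0, would be an interior vertex of [B]. At level 0
    the atom [B] shows only its two ends, and later atoms start beyond its interior. *)
Lemma adim_leq (A B : atom K n) (L L' : seq (atom K n)) x y (v : ch_mor n (atgt B) y) :
  good_atom A -> good_atom B -> asrc A = x -> asrc B = x -> acomp L' v ->
  atoms_edges (A :: L) = atoms_edges (B :: L') ->
  (forall z, z = x \/ atoms_vset ord0 (A :: L) z -> z = x \/ atoms_vset ord0 (B :: L') z) ->
  adim B <= adim A.
Proof.
move=> gA gB Ax Bx vL' E AB; rewrite leqNgt; apply/negP => lt_AB.
(* The last edge of [A] is also an edge of [B]; its end is the target of [A] and the vertex of [B]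
   with index [adim A]. *)
have kA : (adim A).-1 < adim A by rewrite prednK // good_dim.
have kB : (adim A).-1 < adim B by lia.
have := atoms_prefix gA gB (etrans Ax (esym Bx)) E (ltnW lt_AB)
  (erefl : Ordinal kA = Ordinal kB :> nat).
move/(congr1 (fun e => vertex e ord_max)); rewrite !vertex_sact !ffunE /=.
have Ad : 0 < adim A := good_dim gA.
have -> : lift ord0 (Ordinal kA) = ord_max by apply/val_inj; rewrite /= /bump; lia.
set j := lift ord0 (Ordinal kB) => tA.
have jA : j = adim A :> nat by rewrite /= /bump; lia.
have jnd := nondegenerate_vertex_inj HK (good_nd gB).
have : atgt A = x \/ atoms_vset ord0 (B :: L') (atgt A).
  apply: AB; right; left; exists ord_max => //.
  by rewrite (good_joints gA) !inE eqxx orbT.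
rewrite /atgt tA; case=> [|[]].
- rewrite -Bx => /jnd j0; by move: jA; rewrite j0 /=; lia.
- case=> k; rewrite (good_joints gB) !inE => /orP[] /eqP -> /jnd.
    by move=> j0; move: jA; rewrite -j0 /=; lia.
  by move=> j0; move: jA; rewrite -j0 /=; lia.
- by apply: (atom_vertex_notin gB vL'); lia.
Qed.

(** Vertices of a good atom are distinct, so membership in the chain is read off in [K]. Only the
    last vertex can recur in later atoms, and it lies in every subset anyway. *)
Lemma good_chain_sub (A : atom K n) (c : ch_chain ord0 ord_max n) (L L' : seq (atom K n)) x y
    (v : ch_mor n (atgt A) y) p :
  good_atom A -> asrc A = x -> acomp L' v ->
  (forall z, z = x \/ atoms_vset p (Atom (asimp A) c :: L) z ->
             z = x \/ atoms_vset p (A :: L') z) ->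
  c p \subset achain A p.
Proof.
move=> gA Ax vL' cA; apply/subsetP => k kc.
have jnd := nondegenerate_vertex_inj HK (good_nd gA).
have /ch_faceP[A0 Am _] := chain_face (achain A) p.
have [] : vertex (asimp A) k = x \/ atoms_vset p (A :: L') (vertex (asimp A) k).
- by apply: cA; right; left; exists k.
- by rewrite -Ax => /jnd ->.
case=> [[l lA /jnd <- //]|kL'].
have [km|km] := ltnP k (adim A); first by case: (atom_vertex_notin gA vL' km kL').
by rewrite (_ : k = ord_max) //; apply/val_inj/anti_leq; rewrite -ltnS ltn_ord.
Qed.

(** The hypotheses compare invariants and leave [q] and [q'] unrelated, because in the induction the
    tails [v] and [v'] are not known to agree. *)
Lemma acomp_inj (L L' : seq (atom K n)) x y (q q' : ch_mor n x y) :
  all_good L -> all_good L' -> acomp L q -> acomp L' q' ->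
  atoms_edges L = atoms_edges L' ->
  (forall p z, z = x \/ atoms_vset p L z <-> z = x \/ atoms_vset p L' z) -> L = L'.
Proof.
have nil_edges (B : atom K n) L2 : good_atom B -> atoms_edges (B :: L2) <> [::].
  move=> gB; rewrite /atoms_edges /= good_atom_edges // => /(congr1 size).
  by rewrite size_cat size_map size_enum_ord /=; have := good_dim gB; lia.
elim: L L' x q q' => [|A L IH] [|B L'] x q q' //=.
- by move=> _ [gB _] _ _ /esym/nil_edges-/(_ gB).
- by move=> [gA _] _ _ _ /nil_edges-/(_ gA).
move=> [gA gL] [gB gL'] [t [ex [et [v [_ vL]]]]] [t' [ex' [et' [v' [_ vL']]]]] E V.
subst t t'.
have dAB : adim B = adim A.
  apply/anti_leq/andP; split.
    by apply: (adim_leq gA gB ex ex' vL' E) => z /(V _ _).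
  by apply: (adim_leq gB gA ex' ex vL (esym E)) => z /(V _ _).
case: A B dAB gA gB ex ex' v v' vL vL' E V => [m s c] [m' s' c'] /= mm'; subst m'.
move=> gA gB ex ex' v v' vL vL' E V.
have pre := atoms_prefix gA gB (etrans ex (esym ex')) E (leqnn m).
(* The common edges are the components of the Segal map, which is injective on nondegenerate
   simplices. *)
have ss' : s' = s.
  apply: (segal_inj HK (good_dim gA) (good_nd gB) (good_nd gA)).
  apply: eq_exist; apply/funext => k; exact/esym/pre.
subst s'.
have cc' : c' = c.
  apply/chainP => p; apply/eqP; rewrite eqEsubset; apply/andP; split.
    by apply: (good_chain_sub (L := L') gA ex vL) => z /(V p).
  by apply: (good_chain_sub (L := L) gB ex' vL') => z /(V p).
subst c'.
congr (_ :: _); apply: (IH L' _ v v') => //.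
  move: E; rewrite /atoms_edges /= => /(congr1 (drop (size (set_edges s (c ord_max))))).
  by rewrite !drop_size_cat.
(* To cancel the head: a vertex of [s] that also lies above the target of the head is that target,
   by antisymmetry. *)
have tail (L1 L2 : seq (atom K n)) (v1 : ch_mor n (atgt (Atom s c)) y) p z :
    acomp L1 v1 -> (z = x \/ atoms_vset p (Atom s c :: L1) z -> z = x \/ atoms_vset p (Atom s c :: L2) z) ->
    z = atgt (Atom s c) \/ atoms_vset p L1 z -> z = atgt (Atom s c) \/ atoms_vset p L2 z.
  move=> vL1 H [->|zL1]; first by left.
  have tz := acomp_sle vL1 zL1.
  have zk (k : 'I_m.+1) : vertex s k = z -> z = atgt (Atom s c).
    move=> kz; apply: (sle_antisym HK) => //.
    by rewrite -kz; apply: sle_vertex; exact: leq_ord.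
  by case: H => [|zx|[[k _]|]]; [right; right|left; apply: (zk ord0); rewrite zx|move/zk; left|right].
by move=> p z; split; [apply: (tail L L' v) => // /V|apply: (tail L' L v') => // /V].
Qed.

Lemma acomp_functional (L L' : seq (atom K n)) x y (q : ch_mor n x y) :
  all_good L -> all_good L' -> acomp L q -> acomp L' q -> L = L'.
Proof.
move=> gL gL' cL cL'; apply: (acomp_inj gL gL' cL cL').
  by rewrite -(acomp_edges cL) (acomp_edges cL').
by move=> p z; rewrite -(acomp_vset p z cL) -(acomp_vset p z cL').
Qed.

End Uniqueness.

(** * Necklaces presented by atoms *)

Lemma sf_hom_at_mul (C D : scat) (F : sfunctor C D) (x y z : C) (x' y' z' : D)
    (ex : F x = x') (ey : F y = y') (ez : F z = z') n (u : shom x y n) (v : shom y z n) :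
  sf_hom_at F ex ez n (smul u v) = smul (sf_hom_at F ex ey n u) (sf_hom_at F ey ez n v).
Proof. by case: _ / ex; case: _ / ey; case: _ / ez; exact: sf_mul. Qed.

Section ChFunAt.
Variables (K L : sset) (f : smap K L) (n : nat).

Lemma sf_hom_at_gen m (s : K m) (i j : 'I_m.+1) (c : ch_chain i j n) x y x' y'
    (ex : vertex s i = x) (ey : vertex s j = y) (fx : f 0 x = x') (fy : f 0 y = y')
    (ex' : vertex (f m s) i = x') (ey' : vertex (f m s) j = y') :
  sf_hom_at (ch_fun f) fx fy n (ch_gen c ex ey) = ch_gen c ex' ey'.
Proof.
case: _ / fx in ex' *; case: _ / fy in ey' *.
rewrite /sf_hom_at /= ch_mor_mapE /=.
by rewrite (Prop_irrelevance (ch_word_map_subproof f ex) ex') (Prop_irrelevance (ch_word_map_subproof f ey) ey').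
Qed.

Lemma ch_gen_congr m (s s' : K m) (i j : 'I_m.+1) (c : ch_chain i j n) x y
    (ex : vertex s i = x) (ey : vertex s j = y) (ex' : vertex s' i = x) (ey' : vertex s' j = y) :
  s = s' -> ch_gen c ex ey = ch_gen c ex' ey'.
Proof. by move=> E; subst s'; rewrite (Prop_irrelevance ex ex') (Prop_irrelevance ey ey'). Qed.

Lemma sf_hom_at_map M (g : smap L M) x y x' y' (u : ch_mor n x y)
    (ex : ch_fun g (f 0 x) = x') (ey : ch_fun g (f 0 y) = y')
    (ex' : ch_fun (scomp g f) x = x') (ey' : ch_fun (scomp g f) y = y') :
  sf_hom_at (ch_fun g) ex ey n (ch_mor_map f u) = sf_hom_at (ch_fun (scomp g f)) ex' ey' n u.
Proof.
rewrite (Prop_irrelevance ex' ex) (Prop_irrelevance ey' ey).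
case: _ / ex; case: _ / ey; elim/quot_ind: u => w.
by rewrite -/(ch_cl w) /sf_hom_at /= !ch_mor_mapE -ch_word_map_comp.
Qed.

Lemma acomp_at (A : seq (atom K n)) x y (q : ch_mor n x y) x' y'
    (ex : ch_fun f x = x') (ey : ch_fun f y = y') :
  acomp A q -> acomp (map (atom_map f) A) (sf_hom_at (ch_fun f) ex ey n q).
Proof. by case: _ / ex; case: _ / ey; exact: acomp_map. Qed.

End ChFunAt.

Lemma sconst0 (K : sset) (x : K 0) : sconst x 0 = x.
Proof. exact: vertex0. Qed.

Lemma acomp_nil_eq (K : sset) n (x y : K 0) (q q' : ch_mor n x y) :
  acomp [::] q -> acomp [::] q' -> q = q'.
Proof. by case=> e -> [e' ->]; rewrite (Prop_irrelevance e e'). Qed.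

Lemma smap_stdsimplex_eq (K : sset) m (f g : smap (stdsimplex m) K) :
  f m (did m) = g m (did m) -> f = g.
Proof.
move=> fg; apply/smapP => q t; have -> : t = sact (t : dmap q m) (did m : stdsimplex m m).
  by rewrite /= did_comp.
by rewrite !smap_nat fg.
Qed.

Lemma smap_wedge_eq (K : sset) m (X : bsset) (f g : smap (wedge (bstdsimplex m) X) K) :
  f m (wedge_inl (bstdsimplex m) X m (did m)) = g m (wedge_inl (bstdsimplex m) X m (did m)) ->
  scomp f (wedge_inr (bstdsimplex m) X) = scomp g (wedge_inr (bstdsimplex m) X) -> f = g.
Proof.
move=> fg0 fg1; apply/smapP => q; elim/quot_ind => -[t|t].
  have E : scomp f (wedge_inl (bstdsimplex m) X) = scomp g (wedge_inl (bstdsimplex m) X).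
    exact: smap_stdsimplex_eq.
  exact: (congr1 (fun h : smap (stdsimplex m) K => h q t) E).
exact: (congr1 (fun h : smap X K => h q t) fg1).
Qed.

Notation winl m m' ms := (wedge_inl (bstdsimplex m) (beads_wedge m' ms)).
Notation winr m m' ms := (wedge_inr (bstdsimplex m) (beads_wedge m' ms)).

(* [rep f u A L]: the beads of [f] and the chains composing [u] are those of the atoms [A :: L]. *)
Fixpoint rep (K : sset) n m ms :
    smap (beads_wedge m ms) K -> ch_base (beads_wedge m ms) n -> atom K n -> seq (atom K n) -> Prop :=
  match ms with
  | [::] => fun f u A L => L = [::] /\ exists (c : ch_chain (ord0 : 'I_m.+1) ord_max n)
      (e0 : vertex (did m : stdsimplex m m) ord0 = bsrc (bstdsimplex m))
      (e1 : vertex (did m : stdsimplex m m) ord_max = btgt (bstdsimplex m)),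
      A = Atom (f m (did m)) c /\ u = ch_gen c e0 e1
  | m' :: ms' => fun f u A L => exists (c : ch_chain (ord0 : 'I_m.+1) ord_max n)
      (e0 : vertex (winl m m' ms' m (did m)) ord0 = bsrc (beads_wedge m (m' :: ms')))
      (e1 : vertex (winl m m' ms' m (did m)) ord_max = winr m m' ms' 0 (bsrc (beads_wedge m' ms')))
      B L' v,
      [/\ A = Atom (f m (winl m m' ms' m (did m))) c, L = B :: L',
          u = ch_mul (ch_gen c e0 e1) (ch_mor_map (winr m m' ms') v)
        & rep (scomp f (winr m m' ms')) v B L']
  end.

(** Substitutes along an equality of atoms of different formal dimensions without transporting
    simplices or chains. *)
Lemma atom_eq_ind (K : sset) n (Q : forall m, K m -> ch_chain (ord0 : 'I_m.+1) ord_max n -> Prop)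
    m (s : K m) c m' (s' : K m') c' :
  Atom s c = Atom s' c' -> Q m s c -> Q m' s' c'.
Proof.
move=> E H; have : (fun A : atom K n => Q (adim A) (asimp A) (achain A)) (Atom s c) by [].
by rewrite E.
Qed.

(* Stated as a Leibniz equality of the dependent tuples (m, ms, f, u), to avoid transports. *)
Lemma rep_functional (K : sset) n
    (P : forall m ms, smap (beads_wedge m ms) K -> ch_base (beads_wedge m ms) n -> Prop)
    m ms (f : smap (beads_wedge m ms) K) u m' ms' (f' : smap (beads_wedge m' ms') K) u' A L :
  rep f u A L -> rep f' u' A L -> P m ms f u -> P m' ms' f' u'.
Proof.
elim: ms ms' m m' f f' u u' A L P => [|m1 ms IH] [|m1' ms'] m m' f f' u u' A L P /=.
- move=> [_ [c [e0 [e1 [-> ->]]]]] [_ [c' [e0' [e1' [E ->]]]]] Pf.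
  pose Q q (s : K q) (d : ch_chain (ord0 : 'I_q.+1) ord_max n) :=
    forall (g : smap (beads_wedge q [::]) K) (e0 : vertex (did q : stdsimplex q q) ord0 = bsrc (bstdsimplex q))
      (e1 : vertex (did q : stdsimplex q q) ord_max = btgt (bstdsimplex q)),
    g q (did q) = s -> P q [::] g (ch_gen d e0 e1).
  apply: (@atom_eq_ind _ _ Q _ _ _ _ _ _ E _ f' e0' e1' erefl).
  move=> g e2 e3 /smap_stdsimplex_eq ->.
  by rewrite (Prop_irrelevance e2 e0) (Prop_irrelevance e3 e1).
- by move=> [-> _] [? [? [? [? [? [? []]]]]]].
- by move=> [? [? [? [? [? [? [_ -> _ _]]]]]]] [].
move=> [c [e0 [e1 [B [L1 [v [-> -> -> r]]]]]]] [c' [e0' [e1' [B' [L1' [v' [E [EB EL] -> r']]]]]]] Pf.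
subst B' L1'.
(* Two substitutions: [Q] varies the first bead with the tail fixed, then [P'] varies the tail with
   the first bead fixed. *)
pose Q q (s : K q) (d : ch_chain (ord0 : 'I_q.+1) ord_max n) :=
  forall (g : smap (beads_wedge q (m1' :: ms')) K)
    (e0 : vertex (winl q m1' ms' q (did q)) ord0 = bsrc (beads_wedge q (m1' :: ms')))
    (e1 : vertex (winl q m1' ms' q (did q)) ord_max = winr q m1' ms' 0 (bsrc (beads_wedge m1' ms'))),
  g q (winl q m1' ms' q (did q)) = s -> scomp g (winr q m1' ms') = scomp f' (winr m' m1' ms') ->
  P q (m1' :: ms') g (ch_mul (ch_gen d e0 e1) (ch_mor_map (winr q m1' ms') v')).
apply: (@atom_eq_ind _ _ Q _ _ _ _ _ _ E _ f' e0' e1' erefl erefl).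
pose P' q qs (h : smap (beads_wedge q qs) K) (w : ch_base (beads_wedge q qs) n) :=
  forall (g : smap (beads_wedge m (q :: qs)) K)
    (e0 : vertex (winl m q qs m (did m)) ord0 = bsrc (beads_wedge m (q :: qs)))
    (e1 : vertex (winl m q qs m (did m)) ord_max = winr m q qs 0 (bsrc (beads_wedge q qs))),
  g m (winl m q qs m (did m)) = f m (winl m m1 ms m (did m)) -> scomp g (winr m q qs) = h ->
  P m (q :: qs) g (ch_mul (ch_gen c e0 e1) (ch_mor_map (winr m q qs) w)).
apply: (IH _ _ _ _ _ _ _ _ _ P' r r') => g e2 e3 g0 g1.
by rewrite (smap_wedge_eq g0 g1) (Prop_irrelevance e2 e0) (Prop_irrelevance e3 e1).
Qed.

Lemma rep_map (K K' : sset) (g : smap K K') n m ms (f : smap (beads_wedge m ms) K) u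
    (A : atom K n) L :
  rep f u A L -> rep (scomp g f) u (atom_map g A) (map (atom_map g) L).
Proof.
elim: ms m f u A L => [|m' ms IH] m f u A L /=.
  by case=> -> [c [e0 [e1 [-> ->]]]]; split=> //; exists c, e0, e1.
case=> c [e0 [e1 [B [L' [v [-> -> -> r]]]]]].
exists c, e0, e1, (atom_map g B), (map (atom_map g) L'), v; split=> //.
have -> : scomp (scomp g f) (winr m m' ms) = scomp g (scomp f (winr m m' ms)) by exact: smapP.
exact: IH r.
Qed.

Lemma rep_tot_nondeg (K : sset) n m ms (f : smap (beads_wedge m ms) K) u (A : atom K n) L :
  rep f u A L -> all_good (A :: L) -> tot_nondeg f.
Proof.
elim: ms m f u A L => [|m' ms IH] m f u A L /=.
  by case=> -> [c [e0 [e1 [-> _]]]] [[]].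
case=> c [e0 [e1 [B [L' [v [-> -> _ r]]]]]] [[_ fnd _ _] gL].
by split=> //; exact: IH r gL.
Qed.

Lemma rep_pos (K : sset) n m ms (f : smap (beads_wedge m ms) K) u (A : atom K n) L :
  rep f u A L -> all_good (A :: L) -> all (fun q => 0 < q) (m :: ms).
Proof.
elim: ms m f u A L => [|m' ms IH] m f u A L /=.
  by case=> -> [c [e0 [e1 [-> _]]]] [[/= ->]].
case=> c [e0 [e1 [B [L' [v [-> -> _ r]]]]]] [[/= -> _ _ _] gL].
exact: IH r gL.
Qed.

(** The simplices become beads: composability lets their representing maps glue along the wedge, and
    [u] is the composite of the chains inside the beads. *)
Lemma rep_exists (K : sset) n (A : atom K n) L x y (q : ch_mor n x y) : acomp (A :: L) q ->
  exists m ms (f : smap (beads_wedge m ms) K) (u : ch_base (beads_wedge m ms) n)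
    (ex : f 0 (bsrc (beads_wedge m ms)) = x) (ey : f 0 (btgt (beads_wedge m ms)) = y),
    rep f u A L /\ q = sf_hom_at (ch_fun f) ex ey n u.
Proof.
elim: L A x q => [|B L IH] A x q.
  case: A => m s c [z [ex [ez [v [-> [e ->]]]]]].
  case: _ / e; rewrite ch_mul1r.
  have e0 : vertex (did m : stdsimplex m m) ord0 = bsrc (bstdsimplex m).
    by rewrite vertex_stdsimplex didE.
  have e1 : vertex (did m : stdsimplex m m) ord_max = btgt (bstdsimplex m).
    by rewrite vertex_stdsimplex didE.
  exists m, [::], (yoneda s), (ch_gen c e0 e1), ex, ez; split.
    by split=> //; exists c, e0, e1; rewrite /= sact_id.
  have ex' : vertex (yoneda s m (did m)) ord0 = x by rewrite /= sact_id.
  have ez' : vertex (yoneda s m (did m)) ord_max = z by rewrite /= sact_id.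
  apply: etrans (esym (sf_hom_at_gen c e0 e1 _ _ ex' ez')).
  by apply: ch_gen_congr; rewrite /= sact_id.
case: A => m s c [z [ex [ez [v [-> /IH]]]]].
case=> m' [ms [f [u [fx [fy [r ->]]]]]].
have glue : yoneda s 0 (btgt (bstdsimplex m)) = f 0 (bsrc (beads_wedge m' ms)) by rewrite fx.
pose F := @copair (bstdsimplex m) (beads_wedge m' ms) K _ _ glue.
have Fl : F m (winl m m' ms m (did m)) = s by rewrite copair_inl /= sact_id.
have Fr : scomp F (winr m m' ms) = f by apply/smapP => k t; exact: copair_inr.
have e0 : vertex (winl m m' ms m (did m)) ord0 = bsrc (beads_wedge m (m' :: ms)).
  by rewrite vertex_smap vertex_stdsimplex didE.
have e1 : vertex (winl m m' ms m (did m)) ord_max = winr m m' ms 0 (bsrc (beads_wedge m' ms)).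
  rewrite vertex_smap vertex_stdsimplex didE.
  (* The defining identification of the wedge, in dimension 0, where [sconst] is the identity. *)
  have := qclass_eq (WedgeGlue (bstdsimplex m) (beads_wedge m' ms) 0).
  by rewrite !sconst0.
have Fx : F 0 (bsrc (beads_wedge m (m' :: ms))) = x by rewrite -e0 -vertex_smap Fl.
have Fz : F 0 (winr m m' ms 0 (bsrc (beads_wedge m' ms))) = z by rewrite copair_inr.
have Fy : F 0 (btgt (beads_wedge m (m' :: ms))) = y by rewrite /F copair_inr.
exists m, (m' :: ms), F, (ch_mul (ch_gen c e0 e1) (ch_mor_map (winr m m' ms) u)), Fx, Fy; split.
  by exists c, e0, e1, B, L, u; rewrite Fl Fr.
apply: etrans (esym (sf_hom_at_mul (F := ch_fun F) Fx Fz Fy (ch_gen c e0 e1 : shom (s := ch _) _ _ n)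
  (ch_mor_map (winr m m' ms) u))).
congr (@smul (ch K) _ _ _ _ _ _).
  have ex' : vertex (F m (winl m m' ms m (did m))) ord0 = x by rewrite Fl.
  have ez' : vertex (F m (winl m m' ms m (did m))) ord_max = z by rewrite Fl.
  apply: etrans (esym (sf_hom_at_gen c e0 e1 Fx Fz ex' ez')); exact: ch_gen_congr.
rewrite (sf_hom_at_map _ _ _ Fz Fy).
by apply: sfunctor_eq_hom; rewrite Fr.
Qed.

(** * Bijectivity and naturality of the comparison map *)

Section Comparison.
Variables (K : sset) (HK : one_ordered K) (a b : K 0) (n : nat).

Local Notation cls T u := (colim_in (nec_tnd_ch a b) T n u).

(** The chain is unchanged, so only nondegeneracy of the simplices is at stake; total nondegeneracy
    of [T] provides it. *)
Lemma all_good_map (T : NecTnd a b) (L : seq (atom (nec_neck (sval T)) n)) :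
  all_good L -> all_good (map (atom_map (nec_map (sval T))) L).
Proof.
elim: L => //= A L IH [[Ad And A0 Am] /IH gL]; split=> //; split=> //=.
exact: (tot_nondeg_nondegenerate HK (svalP T)).
Qed.

Lemma nec_comparisonE (T : NecTnd a b) (u : nec_tnd_ch a b T n) :
  nec_comparison a b n (cls T u) = ch_base_map (nec_map (sval T)) n u.
Proof. by rewrite /= qliftE. Qed.

Definition mk_tnd m ms (f : smap (beads_wedge m ms) K)
    (pos : (ms == [::]) || all (fun q => 0 < q) (m :: ms))
    (ex : f 0 (bsrc (beads_wedge m ms)) = a) (ey : f 0 (btgt (beads_wedge m ms)) = b)
    (fnd : tot_nondeg f) : NecTnd a b :=
  exist (@tnd K a b) (@NecOb K a b (Necklace pos) (@BMap (Necklace pos) (BSSet a b) f ex ey)) fnd.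

(** An identity has no atoms, hence no beads to build a necklace from; the necklace [F[0]]
    represents it. *)
Definition point_tnd (e : a = b) : NecTnd a b :=
  @mk_tnd 0 [::] (yoneda a) isT (vertex0 a ord0) (etrans (vertex0 a ord_max) e)
    (@nondegenerate_dim0 K _).

Lemma point_src_tgt : bsrc (bstdsimplex 0) = btgt (bstdsimplex 0).
Proof. by congr (dconst 0 _); apply/val_inj. Qed.

Definition point_one : ch_base (bstdsimplex 0) n :=
  hom_cast (C := ch (stdsimplex 0)) erefl point_src_tgt n
    (sone (s := ch (stdsimplex 0)) (bsrc (bstdsimplex 0)) n).

(** The inclusion of the initial vertex of [T] is a map of necklaces over [K] that carries
    [point_one] to [u]. *)
Lemma cls_nil (T : NecTnd a b) (u : nec_tnd_ch a b T n) (e : a = b) :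
  acomp [::] (u : ch_base (nec_neck (sval T)) n) -> cls T u = cls (point_tnd e) point_one.
Proof.
move=> u1; have [srctgt _] := u1.
set N := nec_neck (sval T) in u1 srctgt *.
pose h : bmap (bstdsimplex 0) N := @BMap (bstdsimplex 0) N (yoneda (bsrc N))
  (vertex0 (bsrc N) ord0) (etrans (vertex0 (bsrc N) ord_max) srctgt).
have hover : bcomp (nec_map (sval T)) h = nec_map (sval (point_tnd e)).
  by apply/bmapP => q t /=; rewrite smap_nat bmap_src.
pose H : nec_hom (sval (point_tnd e)) (sval T) := @NecHom K a b (sval (point_tnd e)) (sval T) h hover.
apply/esym; have -> : u = ch_base_map h n point_one.
  apply: acomp_nil_eq u1 _; apply: (acomp_at (A := [::])); by exists point_src_tgt.
by apply/qclass_eq; exact: (@ColimRel _ (nec_tnd_ch a b) n (point_tnd e) T H).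
Qed.

(** The atoms are taken in [T], so their necklace maps to [T] over [K], and this map identifies the
    two classes in the colimit. *)
Lemma cls_cons (T : NecTnd a b) (u : nec_tnd_ch a b T n) A L :
  all_good (A :: L) -> acomp (A :: L) (u : ch_base (nec_neck (sval T)) n) ->
  exists m ms f pos ex ey fnd (v : ch_base (beads_wedge m ms) n),
    rep f v (atom_map (nec_map (sval T)) A) (map (atom_map (nec_map (sval T))) L)
    /\ cls T u = cls (@mk_tnd m ms f pos ex ey fnd) v.
Proof.
set N := nec_neck (sval T) => gL /rep_exists[m [ms [g [v [gx [gy [r ->]]]]]]].
set f := nec_map (sval T).
pose h : bmap (beads_wedge m ms) N := BMap gx gy.
have pos : (ms == [::]) || all (fun q => 0 < q) (m :: ms) by rewrite (rep_pos r gL) orbT.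
have ex : scomp f h 0 (bsrc (beads_wedge m ms)) = a by rewrite /= gx bmap_src.
have ey : scomp f h 0 (btgt (beads_wedge m ms)) = b by rewrite /= gy bmap_tgt.
have r' := rep_map f r.
have fnd := rep_tot_nondeg r' (all_good_map gL).
exists m, ms, (scomp f h), pos, ex, ey, fnd, v; split=> //.
have hover : bcomp f h = nec_map (sval (mk_tnd pos ex ey fnd)) by exact: bmapP.
pose H : nec_hom (sval (mk_tnd pos ex ey fnd)) (sval T) := @NecHom K a b (sval (mk_tnd pos ex ey fnd)) (sval T) h hover.
by apply/esym/qclass_eq; exact: (@ColimRel _ (nec_tnd_ch a b) n (mk_tnd pos ex ey fnd) T H).
Qed.

Lemma nec_comparison_inj : injective (nec_comparison a b n).
Proof.
elim/quot_ind => -[T u]; elim/quot_ind => -[T' u'].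
rewrite -[qclass _ _]/(cls T u) -[X in _ = X -> _]/(nec_comparison a b n (cls T' u')).
rewrite -[X in _ -> _ = X]/(cls T' u') !nec_comparisonE => E.
have [L gL cL] := acomp_exists (u : ch_base (nec_neck (sval T)) n).
have [L' gL' cL'] := acomp_exists (u' : ch_base (nec_neck (sval T')) n).
have c1 := acomp_at (bmap_src (nec_map (sval T))) (bmap_tgt (nec_map (sval T))) cL.
have c2 := acomp_at (bmap_src (nec_map (sval T'))) (bmap_tgt (nec_map (sval T'))) cL'.
have c2' : acomp (map (atom_map (nec_map (sval T'))) L') (ch_base_map (nec_map (sval T)) n u).
  by rewrite E.
have := acomp_functional HK (all_good_map gL) (all_good_map gL') c1 c2'.
case: L L' gL gL' cL cL' {c1 c2 c2'} => [|A L] [|A' L'] //= gL gL' cL cL'.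
  move=> _; have e : a = b.
    case: cL => e _; apply: etrans (esym (bmap_src (nec_map (sval T)))) _.
    by apply: etrans (bmap_tgt (nec_map (sval T))); rewrite e.
  exact: etrans (cls_nil e cL) (esym (cls_nil e cL')).
move=> EL.
have [m [ms [f [pos [ex [ey [fnd [v [r Ev]]]]]]]]] := cls_cons gL cL.
have [m' [ms' [f' [pos' [ex' [ey' [fnd' [v' [r' Ev']]]]]]]]] := cls_cons gL' cL'.
apply: etrans Ev (etrans _ (esym Ev')).
(* [R] states [rep] for a whole list, so that the equation [EL] between lists can be rewritten in
   it. *)
pose R (l : seq (atom K n)) := if l is B :: M then rep f' v' B M else False.
have {}r' : R (_ :: _) := r'.
rewrite -EL in r'.
pose P q qs (g : smap (beads_wedge q qs) K) (w : ch_base (beads_wedge q qs) n) :=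
  forall pos1 ex1 ey1 fnd1,
    cls (mk_tnd pos ex ey fnd) v = cls (@mk_tnd q qs g pos1 ex1 ey1 fnd1) w.
apply: (rep_functional (P := P) r (r' : rep f' v' _ _)) => pos1 ex1 ey1 fnd1.
by rewrite (Prop_irrelevance pos1 pos) (Prop_irrelevance ex1 ex) (Prop_irrelevance ey1 ey)
  (Prop_irrelevance fnd1 fnd).
Qed.

Lemma nec_comparison_surj (q : ch_mor n a b) : exists z, nec_comparison a b n z = q.
Proof.
have [[|A L] gL cL] := acomp_exists q.
  have [e _] := cL; exists (cls (point_tnd e) point_one); rewrite nec_comparisonE.
  apply: acomp_nil_eq cL; apply: (acomp_at (A := [::])); by exists point_src_tgt.
have [m [ms [f [u [ex [ey [r ->]]]]]]] := rep_exists cL.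
have pos : (ms == [::]) || all (fun q => 0 < q) (m :: ms) by rewrite (rep_pos r gL) orbT.
exists (cls (mk_tnd pos ex ey (rep_tot_nondeg r gL)) u).
by rewrite nec_comparisonE.
Qed.

End Comparison.

(** Naturality is stated on representatives, for maps [h] of necklaces over [f], because composing a
    totally nondegenerate necklace with [f] can create degenerate beads. Both sides are images of
    [u] under the functor induced by the common composite. *)
Theorem corollary2p2p4 (K : sset) (HK : one_ordered K) (a b : K 0) :
  siso (nec_comparison a b) /\
  forall (L : sset) (HL : one_ordered L) (f : smap K L)
    (T : NecTnd a b) (U : NecTnd (f 0 a) (f 0 b))
    (h : bmap (nec_neck (sval T)) (nec_neck (sval U))),
  scomp (nec_map (sval U)) h = scomp f (nec_map (sval T)) ->
  forall (n : nat) (u : ch_base (nec_neck (sval T)) n),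
    sf_hom (ch_fun f) a b n
      (nec_comparison a b n (colim_in (nec_tnd_ch a b) T n u))
    = nec_comparison (f 0 a) (f 0 b) n
        (colim_in (nec_tnd_ch (f 0 a) (f 0 b)) U n (ch_base_map h n u)).
Proof.
split.
  apply: bijective_siso => n; [exact: nec_comparison_inj | exact: nec_comparison_surj].
move=> L _ f T U h hE n u; rewrite !nec_comparisonE /ch_base_map.
have ex : sfcomp (ch_fun f) (ch_fun (nec_map (sval T))) (bsrc (nec_neck (sval T))) = f 0 a.
  exact: congr1 (bmap_src (nec_map (sval T))).
have ey : sfcomp (ch_fun f) (ch_fun (nec_map (sval T))) (btgt (nec_neck (sval T))) = f 0 b.
  exact: congr1 (bmap_tgt (nec_map (sval T))).
have ex' : sfcomp (ch_fun (nec_map (sval U))) (ch_fun h) (bsrc (nec_neck (sval T))) = f 0 a.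
  exact: bmap_src (bcomp (nec_map (sval U)) h).
have ey' : sfcomp (ch_fun (nec_map (sval U))) (ch_fun h) (btgt (nec_neck (sval T))) = f 0 b.
  exact: bmap_tgt (bcomp (nec_map (sval U)) h).
rewrite (sf_hom_at_comp _ _ _ _ ex' ey').
have -> : forall w, sf_hom (ch_fun f) a b n w = sf_hom_at (ch_fun f) erefl erefl n w by [].
rewrite (sf_hom_at_comp _ _ _ _ ex ey).
by apply: sfunctor_eq_hom; rewrite -!ch_fun_comp hE.
Qed.
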